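(* Let $a\neq0$ be a real number and let $F=\{f_1<\cdots<f_k\}$ ($k\ge1$) be a finite set of positive integers for which $\Omega_F^a(n)\ne0$ for all integers $n\ge0$. Define the first order difference operators $$C_F=-\frac{x\,\tilde\Omega_F(x+1)}{a\,\tilde\Omega_{F_\Downarrow}(x)}\mathfrak{s}_{-1}+\frac{\tilde\Omega_F(x)}{\tilde\Omega_{F_\Downarrow}(x)}\mathfrak{s}_0,\qquad E_F=a\frac{\tilde\Omega_{F_\Downarrow}(x+1)}{\tilde\Omega_F(x+1)}\mathfrak{s}_0-a\frac{\tilde\Omega_{F_\Downarrow}(x)}{\tilde\Omega_F(x+1)}\mathfrak{s}_1 .$$ Then $D_{F_\Downarrow}=E_FC_F+(u_F-k-1)\,\mathrm{Id}$ and $D_F=C_FE_F+u_F\,\mathrm{Id}$. Moreover $$C_F\big(c_{n-k-1}^{F_\Downarrow}\big)(x)=(-1)^{u_F+u_{F_\Downarrow}+1}\,\frac{n-u_F}{a}\,c_n^F(x),\qquad n\ge v_F.$$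
   Context: Shift operators: $\mathfrak{s}_l(p)(x)=p(x+l)$; $\mathrm{Id}=\mathfrak{s}_0$. Identities between operators are identities of difference operators with rational coefficients. Charlier polynomials ($a\ne0$): $c_n^a(x)=\frac1{n!}\sum_{j=0}^n(-a)^{n-j}\binom nj\binom xj j!$, $n\ge0$. For a finite set of positive integers $F=\{f_1<\cdots<f_k\}$: $u_F=\sum_{f\in F}f-\binom{k+1}{2}$; $v_F=\sum_{f\in F}f+f_k-\frac{(k-1)(k+2)}2=u_F+f_k+1$; $\sigma_F=\{u_F,u_F+1,\dots\}\setminus\{u_F+f: f\in F\}$; for $n\in\sigma_F$, $c_n^F(x)=c_n^{a;F}(x)$ is the $(k+1)\times(k+1)$ determinant whose first row is $(c^a_{n-u_F}(x+j))_{j=0}^{k}$ and whose $(i+1)$-th row is $(c^a_{f_i}(x+j))_{j=0}^k$, $i=1,\dots,k$; $\Omega_F(x)=\Omega_F^a(x)=\det\big(c_{f_i}^a(x+j-1)\big)_{i,j=1}^k$; $\Lambda_F(x)$ is the $k\times k$ determinant with $i$-th row $(c_{f_i}^a(x),\dots,c_{f_i}^a(x+k-2),c_{f_i}^a(x+k))$; and $$D_F=-x\frac{\Omega_F(x+1)}{\Omega_F(x)}\mathfrak{s}_{-1}+\Big(x+k+a+u_F-a\frac{\Lambda_F(x+1)}{\Omega_F(x+1)}+a\frac{\Lambda_F(x)}{\Omega_F(x)}\Big)\mathfrak{s}_0-a\frac{\Omega_F(x)}{\Omega_F(x+1)}\mathfrak{s}_1 .$$ Involution: $I(F)=\{1,2,\dots,f_k\}\setminus\{f_k-f: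 f\in F\}$. Writing $I(F)=\{g_1<\cdots<g_m\}$, set $\tilde\Omega_F(x)=\tilde\Omega_F^a(x)=\det\big(c_{g_i}^{-a}(-x+j-1)\big)_{i,j=1}^m$. $F_\Downarrow$: if $F=\{1,2,\dots,k\}$ then $F_\Downarrow=\emptyset$; otherwise $s_F=\min\{s\ge1: s<f_s\}$ and $F_\Downarrow=\{f_{s_F}-s_F,\dots,f_k-s_F\}$. Conventions for the empty set: $u_\emptyset=0$, $\sigma_\emptyset=\{0,1,2,\dots\}$, $\Omega_\emptyset=\tilde\Omega_\emptyset=1$, $c_n^\emptyset=c_n^a$, $D_\emptyset=-x\mathfrak{s}_{-1}+(x+a)\mathfrak{s}_0-a\mathfrak{s}_1$. *)

(* Defs.v *)
From HB Require Import structures.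
From mathcomp Require Import all_boot all_order all_algebra.
From mathcomp Require Export reals.

Set Implicit Arguments.
Unset Strict Implicit.
Unset Printing Implicit Defensive.

Import Order.TTheory GRing.Theory Num.Theory.
Local Open Scope ring_scope.

Notation "p %:F" := (@FracField.tofrac _ p) : ring_scope.

(** A finite set of positive integers F = {f_1 < ... < f_k} is given by its
    increasing enumeration, so that f_i is [nth 0 F i.-1], k is [size F] and
    f_k is [last 0 F]. *)

(** The subtractions in [uF], [vF], [invol] and [down] are never truncated when
    F is strictly increasing with positive entries (and nonempty for [vF]). *)

Definition uF (F : seq nat) : nat := (\sum_(f <- F) f - 'C((size F).+1, 2))%N.

Definition vF (F : seq nat) : nat :=
  (\sum_(f <- F) f + last 0 F - ((size F).-1 * (size F + 2)) %/ 2)%N.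

Definition invol (F : seq nat) : seq nat :=
  [seq g <- iota 1 (last 0 F) | g \notin [seq (last 0 F - f)%N | f <- F]].

(** [find] returns a 0-based position, whence the successor: [sF F] is the
    least s >= 1 such that s < f_s. *)
Definition sF (F : seq nat) : nat :=
  (find (fun s => s < nth 0 F s.-1)%N (iota 1 (size F))).+1.

Definition down (F : seq nat) : seq nat :=
  if F == iota 1 (size F) then [::]
  else [seq (f - sF F)%N | f <- drop (sF F).-1 F].

Section Charlier.
Variable R : realType.
Implicit Types (a : R) (F : seq nat).

(** p(x + l) for a polynomial p. *)
Definition pshift (l : int) (p : {poly R}) : {poly R} :=
  p \Po ('X + (l%:~R)%:P).

Definition binpoly (j : nat) : {poly R} :=
  (j`!%:R)^-1 *: \prod_(i < j) ('X - (i%:R)%:P).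

Definition charlier a (n : nat) : {poly R} :=
  (n`!%:R)^-1 *:
    \sum_(j < n.+1) ((- a) ^+ (n - j) * 'C(n, j)%:R * j`!%:R) *: binpoly j.

(** Matrix indices start at 0, so column j of [Omega] has shift j. *)
Definition Omega a F : {poly R} :=
  \det (\matrix_(i < size F, j < size F) pshift j (charlier a (nth 0%N F i))).

Definition Lambda a F : {poly R} :=
  \det (\matrix_(i < size F, j < size F)
          pshift (if j.+1 == size F then j.+1 else j)
                 (charlier a (nth 0%N F i))).

Definition tOmega a F : {poly R} :=
  let G := invol F in
  \det (\matrix_(i < size G, j < size G)
          (charlier (- a) (nth 0%N G i) \Po (- 'X + (j%:R)%:P))).

(** Only meaningful for n in sigma_F, in particular for n >= u_F. *)
Definition cF a F (n : nat) : {poly R} :=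
  \det (\matrix_(i < (size F).+1, j < (size F).+1)
          pshift j (charlier a (nth 0%N ((n - uF F)%N :: F) i))).

(** The field R(x). Difference operators with rational coefficients act on it,
    composition of operators is composition of maps, and the action is
    faithful: distinct shifts are linearly independent over R(x). *)
Definition ratfun := {fraction {poly R}}.

(** f(x + l) for a rational function f; see [shift_frac] for independence of
    the chosen representative. *)
Definition shift (l : int) (f : ratfun) : ratfun :=
  (pshift l \n_(generic_quotient.repr f))%:F
    / (pshift l \d_(generic_quotient.repr f))%:F.

Definition cst (a : R) : ratfun := a%:P%:F.

Definition opD a F : ratfun -> ratfun :=
  let x : ratfun := 'X%:F in
  let k := size F in
  let Om : ratfun := (Omega a F)%:F in
  let Om1 := shift 1 Om in
  let La : ratfun := (Lambda a F)%:F in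
  let La1 := shift 1 La in
  ((- (x * (Om1 / Om))) \*o shift (-1))
  \+ ((x + k%:R + cst a + (uF F)%:R - cst a * (La1 / Om1) + cst a * (La / Om))
        \*o shift 0)
  \+ ((- (cst a * (Om / Om1))) \*o shift 1).

Definition opC a F : ratfun -> ratfun :=
  let x : ratfun := 'X%:F in
  let T : ratfun := (tOmega a F)%:F in
  let Td : ratfun := (tOmega a (down F))%:F in
  ((- (x * shift 1 T / (cst a * Td))) \*o shift (-1))
  \+ ((T / Td) \*o shift 0).

Definition opE a F : ratfun -> ratfun :=
  let T : ratfun := (tOmega a F)%:F in
  let Td : ratfun := (tOmega a (down F))%:F in
  ((cst a * (shift 1 Td / shift 1 T)) \*o shift 0)
  \+ ((- (cst a * (Td / shift 1 T))) \*o shift 1).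

Lemma pshift_eq0 l (p : {poly R}) : (pshift l p == 0) = (p == 0).
Proof.
apply: comp_poly2_eq0; by rewrite size_XaddC.
Qed.

Lemma repr_frac (f : ratfun) (r := generic_quotient.repr f) :
  f = (\n_r)%:F / (\d_r)%:F.
Proof.
have d0 : (\d_r)%:F != 0 :> ratfun by rewrite tofrac_eq0 denom_ratioP.
apply: (canRL (mulfK d0)).
rewrite -[in LHS](generic_quotient.reprK f) -/r; unlock FracField.tofrac.
rewrite -[LHS]FracField.pi_mul; apply/generic_quotient.eqmodP.
rewrite /= FracField.equivfE /FracField.mulf.
by rewrite !numden_Ratio ?mulr1 ?oner_neq0 ?denom_ratioP // mulrC.
Qed.

Lemma shift_frac l (p q : {poly R}) : q != 0 ->
  shift l (p%:F / q%:F) = (pshift l p)%:F / (pshift l q)%:F.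
Proof.
move=> q0; rewrite /shift; set f := p%:F / q%:F.
have := repr_frac f; set r := generic_quotient.repr f => /eqP.
have d0 : \d_r != 0 by exact: denom_ratioP.
rewrite eqr_div ?tofrac_eq0 // -!tofracM tofrac_eq => /eqP E.
apply/eqP; rewrite eqr_div ?tofrac_eq0 ?pshift_eq0 //.
by rewrite -!tofracM /pshift -!comp_polyM E.
Qed.

Lemma shift_tofrac l (p : {poly R}) : shift l p%:F = (pshift l p)%:F.
Proof.
have := shift_frac l p (oner_neq0 _).
by rewrite /pshift comp_polyC !tofrac1 !divr1.
Qed.

(** The conventions for the empty set are instances of the definitions. *)
Lemma uF_nil : uF [::] = 0%N.
Proof. by rewrite /uF big_nil. Qed.

Lemma Omega_nil a : Omega a [::] = 1.
Proof. exact: det_mx00. Qed.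

Lemma tOmega_nil a : tOmega a [::] = 1.
Proof. exact: det_mx00. Qed.

Lemma cF_nil a n : cF a [::] n = charlier a n.
Proof.
by rewrite /cF det_mx11 mxE /= uF_nil subn0 /pshift addr0 comp_polyXr.
Qed.

Lemma opD_nil a : opD a [::] =1
  ((- 'X%:F) \*o shift (-1)) \+ (('X%:F + cst a) \*o shift 0)
  \+ ((- cst a) \*o shift 1).
Proof.
have L : Lambda a [::] = 1 by exact: det_mx00.
move=> f; rewrite /opD L Omega_nil uF_nil !shift_tofrac /pshift comp_polyC.
by rewrite !tofrac1 !divr1 !mulr1 !addr0 subrK.
Qed.

End Charlier.

(* Main.v *)
Require Import Defs.
From mathcomp Require Import all_boot all_order all_algebra.
From mathcomp Require Import reals.
From mathcomp Require Import perm zify ring lra.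

(** Write h_n = c_n^a(x) and w_n(z) = c_n^{-a}(z). The Toeplitz matrices of
    (h_n) and of (w_n(-x)) are inverse to each other, since the generating
    functions of these sequences are exp(-at)(1+t)^x and its inverse. Jacobi's
    complementary minor theorem thus turns Omega_F, the determinant of the
    h_{f-j}, into the determinant of the w_{g-j}(-x), g in G = I(F), which is
    [tOmega]; it also transforms Lambda_F and the polynomials c_n^F. The sign is
    (-1)^(u_F + k), as evaluation at x = 0 shows: there both sides are explicit
    up to positive Vandermonde factors.

    On this dual side, I(F_down) is G without its largest element f_k, so that
    C_F and E_F are one step of a Darboux-Crum transformation. The
    factorizations of the operators reduce to two three-term Pluecker relations
    between Casoratians, the difference equation of the w_g being used to
    express the Casoratian with a gap after the first column by the one with a
    gap before the last.

    For the third claim let r = n - v_F. Adding to the Casoratian of G the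
    gauge-transformed c_r^a gives a determinant M_G, and C_F maps the
    determinant of G without f_k to M_G by the Desnanot-Jacobi identity. The
    mixed sums kappa_g = sum_l h_{r+1+l} w_{g-l} satisfy
    (r+1+g) kappa_g = x h_r(x-1) w_g(-x-1) - a h_r(x) w_g(-x), whence M_G equals
    c_n^F up to a sign, a power of a and the product of the r+1+g, g in G; the
    factor of the largest g is r+1+f_k = n - u_F. *)

Set Implicit Arguments.
Unset Strict Implicit.
Unset Printing Implicit Defensive.

Import Order.TTheory GRing.Theory Num.Theory.
Local Open Scope ring_scope.

(** * Determinants *)

Lemma bump0 i : bump 0 i = i.+1.
Proof. by []. Qed.

Section Determinants.
Variable A : comNzRingType.
Implicit Types (f g h : nat -> nat -> A) (n p q i j : nat).

(** The entries are indexed by all pairs of naturals, so that shifted columns and columns beyond the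
    square are read off the same [f]. *)
Definition detf n f : A := \det (\matrix_(i < n, j < n) f i j).

Lemma eq_detf n f g :
  (forall i j, (i < n)%N -> (j < n)%N -> f i j = g i j) -> detf n f = detf n g.
Proof.
by move=> E; congr (\det _); apply/matrixP => i j; rewrite !mxE E.
Qed.

Lemma detf0 f : detf 0%N f = 1.
Proof. exact: det_mx00. Qed.

Lemma detf_mul n f g :
  detf n (fun i j => \sum_(l < n) f i l * g l j) = detf n f * detf n g.
Proof.
rewrite /detf -det_mulmx; congr (\det _); apply/matrixP => i j; rewrite !mxE.
by apply: eq_bigr => l _; rewrite !mxE.
Qed.

Lemma detf_tr n f : detf n (fun i j => f j i) = detf n f.
Proof.
by rewrite /detf -det_tr; congr (\det _); apply/matrixP => i j; rewrite !mxE.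
Qed.

Lemma detf_upper n f :
  (forall i j, (j < i)%N -> (i < n)%N -> f i j = 0) -> detf n f = \prod_(i < n) f i i.
Proof.
move=> E; rewrite -detf_tr /detf det_trig.
  by apply: eq_bigr => i _; rewrite mxE.
by apply/is_trig_mxP => i j ij; rewrite mxE E.
Qed.

Definition cof n f i j : A :=
  (-1) ^+ (i + j) * detf n (fun k l => f (bump i k) (bump j l)).

Lemma cofE n f (i j : 'I_n.+1) :
  cofactor (\matrix_(i < n.+1, j < n.+1) f i j) i j = cof n f i j.
Proof.
rewrite /cofactor /cof; congr (_ * _); congr (\det _).
by apply/matrixP => k l; rewrite !mxE.
Qed.

Lemma cof_row n f i k : (i < n.+1)%N -> (k < n.+1)%N ->
  \sum_(j < n.+1) f i j * cof n f k j = (i == k)%:R * detf n.+1 f.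
Proof.
move=> il kl; pose M := \matrix_(i < n.+1, j < n.+1) f i j.
have /matrixP/(_ (Ordinal il) (Ordinal kl)) := mul_mx_adj M.
rewrite !mxE mulr_natl => <-; apply: eq_bigr => j _.
by rewrite !mxE cofE.
Qed.

Lemma cof_col n f j k : (j < n.+1)%N -> (k < n.+1)%N ->
  \sum_(i < n.+1) f i j * cof n f i k = (j == k)%:R * detf n.+1 f.
Proof.
move=> jl kl; pose M := \matrix_(i < n.+1, j < n.+1) f i j.
have /matrixP/(_ (Ordinal kl) (Ordinal jl)) := mul_adj_mx M.
rewrite !mxE mulr_natl eq_sym => <-; apply: eq_bigr => i _.
by rewrite !mxE cofE mulrC.
Qed.

Lemma detf_col n f c (v : nat -> A) : (c < n.+1)%N ->
  detf n.+1 (fun i j => if j == c then v i else f i j)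
  = \sum_(i < n.+1) v i * cof n f i c.
Proof.
move=> cn; set g := fun i j => _.
have := cof_col g cn cn; rewrite eqxx mul1r => <-.
apply: eq_bigr => i _; rewrite {1}/g eqxx; congr (_ * (_ * _)).
apply: eq_detf => k l _ _; rewrite /g ifF //.
by apply/negbTE; rewrite eq_sym neq_bump.
Qed.

Lemma bump_lt c l : (l < c)%N -> bump c l = l.
Proof. by move=> lc; rewrite /bump leqNgt lc. Qed.

Lemma cof_last n f : cof n f n n = detf n f.
Proof.
rewrite /cof addnn -signr_odd odd_double mul1r.
by apply: eq_detf => k l kn ln; rewrite !bump_lt.
Qed.

(** Replacing each column in turn by the next one is a derivation, of which this
    is the value on the determinant; hence the value 0 for n = 0. *)
Definition detf_up n f : A :=
  if n is p.+1 then detf n (fun i j => f i (if j == p then n else j)) else 0.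

(** Columns 0, 2, ..., n: the gap that [detf_derivation] produces at the other end. *)
Definition detf_low n f : A :=
  if n is p.+1 then detf n (fun i j => f i (if j == 0 then 0 else j.+1)) else 0.

Lemma detf_upE p f : detf_up p.+1 f = \sum_(i < p.+1) f i p.+1 * cof p f i p.
Proof.
rewrite -(detf_col _ (fun i => f i p.+1)) //.
by apply: eq_detf => i j _ _; case: ifP.
Qed.

Lemma detf_lowE p f :
  detf_low p.+1 f = \sum_(i < p.+1) f i 0%N * cof p (fun i j => f i j.+1) i 0%N.
Proof.
rewrite -(detf_col _ (fun i => f i 0%N)) //.
by apply: eq_detf => i j _ _; case: ifP.
Qed.

(** Three-term Pluecker relation for vectors of length p+1: columns 1, ..., p-1 are common to all
    factors, and columns 0, p, p+1 and the last unit vector are distributed in pairs. The factors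
    containing the unit vector are the minors of size p. *)
Lemma detf_plucker_up p f (f1 := fun i j => f i j.+1) :
  detf p.+1 f1 * detf p f
  = detf_up p.+1 f * detf p f1 - detf_up p f1 * detf p.+1 f.
Proof.
(* S is an entry of adj(f) f1 adj(f1), computed below in two ways. *)
pose S := \sum_(i < p.+1) \sum_(j < p.+1) cof p f i p * (f1 i j * cof p f1 p j).
transitivity S.
  rewrite /S; under eq_bigr => i _ do rewrite -mulr_sumr cof_row //.
  rewrite big_ord_recr big1 /= => [|i _]; last first.
    by rewrite (ltn_eqF (ltn_ord i)) mul0r mulr0.
  by rewrite eqxx cof_last mul1r add0r mulrC.
rewrite /S exchange_big /=.
under eq_bigr => j _ do (under eq_bigr => i _ do rewrite mulrCA mulrA;
  rewrite -mulr_suml).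
rewrite big_ord_recr /= -detf_upE cof_last addrC; congr (_ + _).
case: p f @f1 {S} => [|p] f f1; first by rewrite big_ord0 mul0r oppr0.
rewrite big_ord_recr big1 /= => [|i _]; last first.
  rewrite (@cof_col p.+1 f i.+1) ?ltnS ?eqSS ?(ltn_eqF (ltn_ord i)) ?mul0r //.
  exact: ltnW.
rewrite (@cof_col p.+1 f p.+1) // eqxx mul1r add0r mulrC -mulNr; congr (_ * _).
rewrite /cof addSn addnn exprS -signr_odd odd_double mulr1 mulN1r; congr (- _).
apply: eq_detf => i j ip jp; rewrite bump_lt // /f1; congr (f i _.+1).
case: eqP => [->|ne]; first by rewrite /bump leqnn.
by rewrite bump_lt //; lia.
Qed.

(** Here the common columns are 2, ..., p, and the vectors distributed in pairs are columns 0, 1,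
    p+1 and the last unit vector. *)
Lemma detf_plucker_low p f (f1 := fun i j => f i j.+1) (f2 := fun i j => f i j.+2) :
  detf p.+1 f * detf p f2
  = detf p f1 * detf_low p.+1 f - detf p.+1 f1 * detf_low p f.
Proof.
(* [S] is the entry (0, p) of adj(f1) f adj(f). Contracting [f] with adj(f) leaves only the last
   row; contracting it with adj(f1) leaves only its columns 0 and 1. *)
pose S := \sum_(i < p.+1) \sum_(j < p.+1) cof p f1 i 0 * (f i j * cof p f p j).
have cof0 g i : cof p g i 0%N = (-1) ^+ i * detf p (fun k l => g (bump i k) l.+1).
  by rewrite /cof addn0.
have E g : detf p (fun k l => g (bump p k) l) = detf p g.
  by apply: eq_detf => k l kp lp; rewrite bump_lt.
apply: (can_inj (signrMK p)).
transitivity S.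
  rewrite /S; under eq_bigr => i _ do rewrite -mulr_sumr cof_row //.
  rewrite big_ord_recr big1 /= => [|i _]; last first.
    by rewrite (ltn_eqF (ltn_ord i)) mul0r mulr0.
  by rewrite eqxx cof0 (E f2) mul1r add0r mulrA mulrAC.
rewrite /S exchange_big /=.
under eq_bigr => j _ do (under eq_bigr => i _ do rewrite mulrCA mulrA;
  rewrite -mulr_suml).
rewrite big_ord_recl /= -detf_lowE cof0 (E f1) mulrBr; congr (_ + _).
  by rewrite mulrC -mulrA.
case: p f @f1 @f2 {S cof0 E} => [|p] f f1 f2; first by rewrite big_ord0 !mulr0 oppr0.
have C j k : (j < p.+2)%N -> (k < p.+2)%N ->
    \sum_(i < p.+2) f i j.+1 * cof p.+1 f1 i k = (j == k)%:R * detf p.+2 f1.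
  exact: cof_col.
rewrite big_ord_recl [X in _ + X]big1 /= => [|i _]; last first.
  by rewrite !bump0 C ?mul0r //; have := ltn_ord i; lia.
rewrite bump0 C //= mul1r addr0 /cof addn1 exprS mulN1r mulNr !mulrN mulrCA.
congr (- (_ * (_ * _))).
apply: eq_detf => i j ip jp; rewrite bump_lt //; congr (f i _).
by case: j jp.
Qed.

(** The Desnanot-Jacobi identity, obtained like the Pluecker relations by evaluating one double sum
    in both orders. *)
Lemma detf_desnanot p f (f1 := fun i j => f i j.+1) :
  detf p.+2 f * detf p (fun i j => f i.+1 j.+1)
  = detf p.+1 f * detf p.+1 (fun i j => f i.+1 j.+1)
    - detf p.+1 f1 * detf p.+1 (fun i j => f i.+1 j).
Proof.
(* Summing over [j] first leaves row 0. Summing over [i] first leaves columns 0 and p+1, since the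
   others are columns of [f1] orthogonal to the cofactors of its last column. *)
pose S := \sum_(i < p.+1) \sum_(j < p.+2) cof p f1 i p * (f i j * cof p.+1 f 0 j).
apply: (can_inj (signrMK p)).
transitivity S.
  rewrite /S; under eq_bigr => i _ do rewrite -mulr_sumr cof_row ?ltnS ?(ltnW (ltn_ord i)) //.
  rewrite big_ord_recl [X in _ + X]big1 /= => [|i _]; last by rewrite mul0r mulr0.
  rewrite mul1r addr0 [RHS]mulrC mulrCA; congr (_ * _).
  rewrite /cof add0n; congr (_ * _).
  by apply: eq_detf => k l kp lp; rewrite bump0 bump_lt.
rewrite /S exchange_big /=.
under eq_bigr => j _ do (under eq_bigr => i _ do rewrite mulrCA mulrA;
  rewrite -mulr_suml).
have C j k : (j < p.+1)%N -> (k < p.+1)%N ->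
    \sum_(i < p.+1) f i j.+1 * cof p f1 i k = (j == k)%:R * detf p.+1 f1.
  exact: cof_col.
rewrite big_ord_recl [X in _ + X]big_ord_recr /=.
rewrite [X in _ + (X + _)]big1 ?add0r => [|i _]; last first.
  rewrite bump0 C //; last by rewrite ltnS ltnW.
  by rewrite (ltn_eqF (ltn_ord i)) !mul0r.
rewrite bump0 C // eqxx mul1r mulrBr; congr (_ + _).
  have -> : \sum_(i < p.+1) f i 0%N * cof p f1 i p = (-1) ^+ p * detf p.+1 f.
    have := @cof_col p f 0 0 isT isT; rewrite eqxx mul1r => <-.
    rewrite mulr_sumr; apply: eq_bigr => i _; rewrite /cof addn0 exprD.
    rewrite (@eq_detf _ _ (fun k l => f (bump i k) (bump 0 l))); first by ring.
    by move=> k l kp lp; rewrite (bump_lt lp).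
  by rewrite /cof mul1r mulrA.
rewrite /cof add0n exprS mulN1r !mulNr mulrN mulrCA; congr (- (_ * (_ * _))).
by apply: eq_detf => k l kp lp; rewrite bump0 bump_lt.
Qed.

(** Summing d_i f1_ij times its cofactor by rows gives the left-hand side. By columns, the
    recurrence brings in neighbouring columns, which already occur in the determinant except the one
    past the end and the one before the start; these two give the gapped determinants. *)
Lemma detf_derivation n f (f1 := fun i j => f i j.+1) (d beta gam : nat -> A) alpha :
  (forall i j, (i < n)%N -> (j < n)%N ->
     d i * f1 i j = alpha * f1 i j.+1 + beta j * f1 i j - gam j * f i j) ->
  (\sum_(i < n) d i) * detf n f1
  = alpha * detf_up n f1 + (\sum_(j < n) beta j) * detf n f1
    - gam 0%N * detf_low n f.
Proof.
case: n => [|p] E; first by rewrite !big_ord0 !mul0r !mulr0 addr0 subr0.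
pose S := \sum_(i < p.+1) \sum_(j < p.+1) (d i * f1 i j) * cof p f1 i j.
transitivity S.
  rewrite /S mulr_suml; apply: eq_bigr => i _.
  under eq_bigr => j _ do rewrite -mulrA.
  by rewrite -mulr_sumr cof_row // eqxx mul1r.
have -> : S = \sum_(j < p.+1) (alpha * (\sum_(i < p.+1) f1 i j.+1 * cof p f1 i j)
     + beta j * detf p.+1 f1 - gam j * (\sum_(i < p.+1) f i j * cof p f1 i j)).
  rewrite /S exchange_big /=; apply: eq_bigr => j _.
  have := cof_col f1 (ltn_ord j) (ltn_ord j); rewrite eqxx mul1r => <-.
  rewrite !mulr_sumr -big_split -sumrB; apply: eq_bigr => i _ /=.
  by rewrite E //; ring.
rewrite sumrB big_split /= -mulr_suml -!mulr_sumr; congr (_ * _ + _ - _).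
  rewrite big_ord_recr big1 /= => [|j _]; first by rewrite add0r -detf_upE.
  rewrite cof_col ?ltnS //; last exact: ltnW.
  by rewrite gtn_eqF ?mul0r.
have C j k : (j < p.+1)%N -> (k < p.+1)%N ->
    \sum_(i < p.+1) f i j.+1 * cof p f1 i k = (j == k)%:R * detf p.+1 f1.
  exact: cof_col.
rewrite big_ord_recl [X in _ + X]big1 /= => [|j _]; first by rewrite addr0 -detf_lowE.
rewrite bump0 C ?ltnS //; last exact: ltnW.
by rewrite ltn_eqF ?mul0r ?mulr0.
Qed.

End Determinants.

Lemma rmorph_detf (A B : comNzRingType) (h : {rmorphism A -> B}) n
    (f : nat -> nat -> A) :
  h (detf n f) = detf n (fun i j => h (f i j)).
Proof.
by rewrite /detf -det_map_mx; congr (\det _); apply/matrixP => i j; rewrite !mxE.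
Qed.

(** * Complementary minors and column operations *)

Section Minors.
Variable A : comNzRingType.
Implicit Types (f g h : nat -> nat -> A) (n p q i j : nat).

Lemma detf_row_delta p f c : (c <= p)%N ->
  detf p.+1 (fun i j => if i is i'.+1 then f i' j else (j == c)%:R)
  = (-1) ^+ c * detf p (fun i j => f i (bump c j)).
Proof.
move=> cp; set g := fun i j => _.
have := cof_row g (ltn0Sn p) (ltn0Sn p); rewrite eqxx mul1r => <-.
rewrite (bigD1 (Ordinal (cp : (c < p.+1)%N))) //= eqxx mul1r big1 ?addr0.
  by rewrite /cof add0n.
by move=> j ne; rewrite (negbTE (_ : val j != c)) ?mul0r.
Qed.

(** Moving [v] to the last place costs (-1)^p, after which its cofactors are those of [f] along
    column p and see only columns 0, ..., p-1. *)
Lemma detf_first_col p f (v : nat -> A) :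
  detf p.+1 (fun i j => if j is j'.+1 then f i j' else v i)
  = (-1) ^+ p * \sum_(i < p.+1) v i * cof p f i p.
Proof.
rewrite -(@eq_detf _ _ (fun i j => if j == 0%N then v i else f i j.-1)).
  rewrite detf_col // mulr_sumr; apply: eq_bigr => i _; rewrite [RHS]mulrCA.
  congr (_ * _); rewrite /cof addn0 addnC exprD mulrA mulrA -expr2 sqrr_sign mul1r.
  by congr (_ * _); apply: eq_detf => k l kp lp; rewrite (bump_lt lp).
by move=> i [|j].
Qed.

(** Cofactors along the last column see only the first p columns. Quantifying over the row selection
    [s] lets a column operation such as [detf_pascal] act on all of them at once. *)
Lemma eq_cof_last p f g i :
  (forall s : nat -> nat,
    detf p (fun k l => f (s k) l) = detf p (fun k l => g (s k) l)) ->
  cof p f i p = cof p g i p.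
Proof.
move=> E; rewrite /cof; congr (_ * _).
have H h : detf p (fun k l => h (bump i k) (bump p l))
    = detf p (fun k l => h (bump i k) l) :> A.
  by apply: eq_detf => k l kp lp; rewrite (bump_lt lp).
by rewrite !H E.
Qed.

Lemma detf_scale n f (r c : nat -> A) :
  detf n (fun i j => r i * f i j * c j)
  = (\prod_(i < n) r i) * (\prod_(i < n) c i) * detf n f.
Proof.
pose D (d : nat -> A) i j := if i == j then d i else 0.
have DE d : detf n (D d) = \prod_(i < n) d i.
  rewrite detf_upper => [|i j ji _]; last by rewrite /D gtn_eqF.
  by apply: eq_bigr => i _; rewrite /D eqxx.
rewrite -!DE mulrAC -!detf_mul; apply: eq_detf => i j il jl.
rewrite (bigD1 (Ordinal jl)) //= [X in _ + X]big1 ?addr0; last first.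
  by move=> l ne; rewrite /D (negbTE (_ : val l != j)) ?mulr0.
rewrite /D eqxx; congr (_ * _).
rewrite (bigD1 (Ordinal il)) //= [X in _ + X]big1 ?addr0 ?eqxx //.
by move=> l ne; rewrite eq_sym (negbTE (_ : val l != i)) ?mul0r.
Qed.

Lemma sum_delta n (u : nat -> A) c (x : A) : (c < n)%N ->
  \sum_(l < n) u l * ((nat_of_ord l == c)%:R * x) = u c * x.
Proof.
move=> cn; rewrite (bigD1 (Ordinal cn)) //= eqxx mul1r big1 ?addr0 // => l ne.
by rewrite (negbTE (_ : val l != c)) ?mul0r ?mulr0.
Qed.

(** The sign is chosen before [f]: one sign serves all matrices, so that it can later be found from
    a single evaluation. *)
Lemma detf_rows_perm n (s : seq nat) : perm_eq s (iota 0 n) ->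
  exists e : bool, forall f,
    detf n (fun i j => f (nth 0%N s i) j) = (-1) ^+ e * detf n f.
Proof.
move=> sP; have szs : size s = n by rewrite (perm_size sP) size_iota.
have us : uniq s by rewrite (perm_uniq sP) iota_uniq.
have lt (i : 'I_n) : (nth 0%N s i < n)%N.
  have : nth 0%N s i \in s by rewrite mem_nth // szs.
  by rewrite (perm_mem sP) mem_iota.
have injs : injective (fun k : 'I_n => Ordinal (lt k)).
  move=> i j /(congr1 val) /= /eqP; rewrite nth_uniq ?szs // => /eqP.
  exact: val_inj.
exists (odd_perm (perm injs)) => f.
rewrite /detf -det_perm -det_mulmx -row_permE; congr (\det _).
by apply/matrixP => i j; rewrite !mxE permE.
Qed.

Lemma detf_cols_perm n (s : seq nat) : perm_eq s (iota 0 n) ->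
  exists e : bool, forall f,
    detf n (fun i j => f i (nth 0%N s j)) = (-1) ^+ e * detf n f.
Proof.
move=> /detf_rows_perm[e E]; exists e => f.
by rewrite -detf_tr (E (fun i j => f j i)) detf_tr.
Qed.

Lemma sum_nth n (s : seq nat) (F : nat -> A) : size s = n ->
  \sum_(i < n) F (nth 0%N s i) = \sum_(c <- s) F c.
Proof. by move=> <-; rewrite (big_nth 0%N) big_mkord. Qed.

(** Jacobi's complementary minor theorem. *)
Lemma detf_compl p q (r1 r2 c1 c2 : seq nat) :
  size r1 = p -> size c1 = p -> size r2 = q -> size c2 = q ->
  perm_eq (r1 ++ r2) (iota 0 (p + q)) -> perm_eq (c1 ++ c2) (iota 0 (p + q)) ->
  exists e : bool, forall L V : nat -> nat -> A,
    (forall i j, (i < j)%N -> L i j = 0) -> (forall i, L i i = 1) ->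
    (forall i l, (i < p + q)%N -> (l < p + q)%N ->
       \sum_(j < p + q) L i j * V j l = (i == l)%:R) ->
    detf p (fun i j => L (nth 0%N r1 i) (nth 0%N c1 j))
    = (-1) ^+ e * detf q (fun i j => V (nth 0%N c2 i) (nth 0%N r2 j)).
Proof.
move=> sr1 sc1 sr2 sc2 rP cP.
have [e1 E1] := detf_rows_perm rP; have [e2 E2] := detf_cols_perm cP.
exists (e1 (+) e2) => L V L0 L1 LV.
set r := r1 ++ r2 in rP E1; set c := c1 ++ c2 in cP E2.
have detL : detf (p + q) (fun i j => L (nth 0%N r i) (nth 0%N c j))
    = (-1) ^+ (e1 (+) e2).
  rewrite (E1 (fun i j => L i (nth 0%N c j))) (E2 L) signr_addb.
  rewrite [detf _ L](_ : _ = 1) ?mulr1 // -detf_tr detf_upper => [|i j ji _].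
    by rewrite big1.
  exact: L0.
pose B a b (u v : seq nat) : 'M_(a, b) :=
  \matrix_(i < a, j < b) L (nth 0%N u i) (nth 0%N v j).
pose Y a b (u v : seq nat) : 'M_(a, b) :=
  \matrix_(i < a, j < b) V (nth 0%N u i) (nth 0%N v j).
have EB : detf (p + q) (fun i j => L (nth 0%N r i) (nth 0%N c j))
    = \det (block_mx (B p p r1 c1) (B p q r1 c2) (B q p r2 c1) (B q q r2 c2)).
  congr (\det _); apply/matrixP => i j; rewrite !mxE.
  case: splitP => i' ->; rewrite !mxE; case: splitP => j' ->;
    rewrite !mxE /r /c !nth_cat ?sr1 ?sc1 ?ltn_ord //;
    by rewrite ?ltnNge ?leq_addr /= ?addKn.
have mem_lt (s t : seq nat) (x : nat) : perm_eq (s ++ t) (iota 0 (p + q)) ->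
    (x \in s) || (x \in t) -> (x < p + q)%N.
  by move=> sP; rewrite -mem_cat (perm_mem sP) mem_iota.
have BY a (u : seq nat) : size u = a -> (forall x, x \in u -> (x < p + q)%N) ->
    B a p u c1 *m Y p q c1 r2 + B a q u c2 *m Y q q c2 r2
    = \matrix_(i, j) (nth 0%N u i == nth 0%N r2 j)%:R.
  move=> su ulP; apply/matrixP => i j; rewrite !mxE.
  under eq_bigr => l _ do rewrite !mxE.
  under [X in _ + X]eq_bigr => l _ do rewrite !mxE.
  pose F x := L (nth 0%N u i) x * V x (nth 0%N r2 j).
  rewrite (@sum_nth _ c1 F sc1) (@sum_nth _ c2 F sc2) -big_cat (perm_big _ cP) /=.
  rewrite -[X in iota 0 X]subn0 -/(index_iota 0 (p + q)) big_mkord LV //.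
    by rewrite ulP // mem_nth // su.
  by apply: (mem_lt _ _ _ rP); rewrite mem_nth ?orbT // sr2.
(* The permuted [L] is multiplied by the columns [r2] of its inverse, completed by an identity
   block. The result is block lower triangular, and comparing determinants gives the theorem, the
   determinant of the permuted [L] being a sign. *)
have prod : block_mx (B p p r1 c1) (B p q r1 c2) (B q p r2 c1) (B q q r2 c2)
    *m block_mx 1%:M (Y p q c1 r2) 0 (Y q q c2 r2)
    = block_mx (B p p r1 c1) 0 (B q p r2 c1) 1%:M.
  have ur : uniq r by rewrite (perm_uniq rP) iota_uniq.
  rewrite mulmx_block !mulmx1 !mulmx0 !addr0 !BY //; first last.
  - by move=> x xr1; apply: (mem_lt _ _ _ rP); rewrite xr1.
  - by move=> x xr2; apply: (mem_lt _ _ _ rP); rewrite xr2 orbT.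
  congr (block_mx _ _ _ _); apply/matrixP => i j; rewrite !mxE.
    have := ur; rewrite cat_uniq => /and3P[_ /hasPn H _].
    have r2j : nth 0%N r2 j \in r2 by rewrite mem_nth // sr2.
    case: eqP => // E; have /negP := H _ r2j.
    by rewrite -E mem_nth // sr1.
  have := ur; rewrite cat_uniq => /and3P[_ _ u2].
  by rewrite nth_uniq ?sr2.
have /(congr1 determinant) := prod.
rewrite det_mulmx det_ublock det_lblock !det1 mul1r mulr1 -EB detL => /esym.
exact.
Qed.

(** Passing from the values at z, z+1, ... to the forward differences at z is a unitriangular column
    operation. *)
Lemma detf_pascal n f h :
  (forall i j, (i < n)%N -> (j < n)%N ->
     f i j = \sum_(l < j.+1) 'C(j, l)%:R * h i l) ->
  detf n f = detf n h.
Proof.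
move=> E; pose B l j : A := 'C(j, l)%:R.
have -> : detf n f = detf n (fun i j => \sum_(l < n) h i l * B l j).
  apply: eq_detf => i j il jn; rewrite E //.
  rewrite (big_ord_widen n (fun l => 'C(j, l)%:R * h i l)) // big_mkcond.
  apply: eq_bigr => l _ /=; rewrite /B mulrC ltnS.
  by case: leqP => // jl; rewrite bin_small ?mulr0.
rewrite detf_mul [X in _ * X]detf_upper ?big1 ?mulr1 // => [i _|i j ji _].
  by rewrite /B binn.
by rewrite /B bin_small.
Qed.

(** Modulo the earlier columns, the last column of [f], of index n, is that of index n of [h] plus n
    times that of index n-1, as binomial(n, n-1) = n. The second term restores the determinant
    without gap. *)
Lemma detf_up_pascal n f h :
  (forall i j, (i < n)%N -> (j <= n)%N ->
     f i j = \sum_(l < j.+1) 'C(j, l)%:R * h i l) ->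
  detf_up n f = detf_up n h + n%:R * detf n h.
Proof.
case: n => [|p] E; first by rewrite mul0r addr0.
pose v i := h i p.+1 + p.+1%:R * h i p.
pose g i j := if j == p then v i else h i j.
have -> : detf_up p.+1 f = detf p.+1 g.
  pose B l j : A := if j == p then (if l == p then 1 else 'C(p.+1, l)%:R)
                    else 'C(j, l)%:R.
  rewrite /= (@eq_detf _ _ _ (fun i j => \sum_(l < p.+1) g i l * B l j)).
    rewrite detf_mul [X in _ * X]detf_upper ?big1 ?mulr1 // => [i _|i j ji ip].
      by rewrite /B; case: eqP => // _; rewrite binn.
    rewrite /B ifF ?bin_small //; lia.
  move=> i j ip; rewrite ltnS => jp; rewrite E //; last by case: ifP; lia.
  case: eqP => [->|/eqP ne].
    rewrite big_ord_recr big_ord_recr /= binn mul1r binSn.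
    rewrite big_ord_recr /= /g /B !eqxx mulr1 /v -addrA [X in _ + X]addrC.
    congr (_ + _); apply: eq_bigr => l _.
    by rewrite mulrC (ltn_eqF (ltn_ord l)).
  rewrite (big_ord_widen p.+1 (fun l => 'C(j, l)%:R * h i l)) // big_mkcond.
  apply: eq_bigr => l _ /=; rewrite /B (negbTE ne) ltnS mulrC /g.
  case: leqP => jl; last by rewrite bin_small ?mulr0.
  by rewrite ifF //; lia.
rewrite detf_col // detf_upE.
have := cof_col h (ltnSn p) (ltnSn p); rewrite eqxx mul1r => <-.
by rewrite mulr_sumr -big_split; apply: eq_bigr => i _ /=; rewrite mulrDl mulrA.
Qed.

End Minors.

(** This is a Vandermonde determinant up to column operations. *)
Lemma detf_ffact_gt0 (R : realDomainType) (s : seq nat) :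
  sorted ltn s -> 0 < detf (size s) (fun i j => ((nth 0 s i) ^_ j)%:R : R).
Proof.
move=> ss; pose P j : {poly R} := \prod_(0 <= l < j) ('X - (l%:R)%:P).
have sP j : size (P j) = j.+1 by rewrite size_prod_XsubC size_iota subn0.
have PE (f j : nat) : (P j).[f%:R] = (f ^_ j)%:R.
  rewrite /P horner_prod; under eq_bigr => l _ do rewrite hornerXsubC.
  elim: j => [|j IH]; first by rewrite big_geq.
  rewrite big_nat_recr //= IH ffactnSr natrM.
  case: (leqP j f) => jf; first by rewrite natrB.
  by rewrite ffact_small // !mul0r.
pose n := size s.
have -> : detf n (fun i j => (nth 0 s i ^_ j)%:R : R)
  = detf n (fun i j => \sum_(l < n) (nth 0%N s i)%:R ^+ l * (P j)`_l).
  apply: eq_detf => i j ip jp; rewrite -PE (@horner_coef_wide _ n) ?sP //.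
  by apply: eq_bigr => l _; rewrite mulrC.
rewrite (detf_mul n (fun i l => (nth 0%N s i)%:R ^+ l) (fun l j => (P j)`_l)).
rewrite [X in _ * X]detf_upper; last first.
  by move=> i j ji _; rewrite nth_default // sP.
rewrite [X in _ * X]big1 ?mulr1 => [|i _]; last first.
  have /monicP := monic_prod_XsubC (index_iota 0 i) xpredT (fun l => l%:R : R).
  by rewrite lead_coefE -/(P i) sP.
pose a : 'rV[R]_n := \row_j (nth 0%N s j)%:R.
have -> : detf n (fun i l => (nth 0%N s i)%:R ^+ l) = \det (Vandermonde n a).
  rewrite -detf_tr; congr (\det _); apply/matrixP => i j; rewrite !mxE //.
rewrite det_Vandermonde prodr_gt0 // => i _; rewrite prodr_gt0 // => j ij.
rewrite !mxE subr_gt0 ltr_nat; apply: (sorted_ltn_nth ltn_trans) => //;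
  rewrite inE; exact: ltn_ord.
Qed.

(** * Charlier polynomials *)

Section CharlierPolynomials.
Variable R : realType.
Implicit Types (a b : R) (z : {poly R}) (n j d : nat).

Lemma natr_poly n : n%:R = (n%:R)%:P :> {poly R}.
Proof. by rewrite polyC_natr. Qed.

Lemma natrS_poly_neq0 n : n.+1%:R != 0 :> {poly R}.
Proof. by rewrite natr_poly polyC_eq0 pnatr_eq0. Qed.

Definition bin_at j z : {poly R} := binpoly R j \Po z.

Lemma bin_atE j z : bin_at j z = (j`!%:R)^-1 *: \prod_(i < j) (z - i%:R).
Proof.
rewrite /bin_at /binpoly comp_polyZ rmorph_prod /=; congr (_ *: _).
by apply: eq_bigr => i _; rewrite comp_polyB comp_polyX comp_polyC natr_poly.
Qed.

Lemma bin_at0 z : bin_at 0%N z = 1.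
Proof. by rewrite bin_atE big_ord0 invr1 scale1r. Qed.

Lemma bin_at_recr j z : j.+1%:R * bin_at j.+1 z = (z - j%:R) * bin_at j z.
Proof.
rewrite !bin_atE big_ord_recr /= natr_poly mul_polyC scalerA factS natrM invfM.
rewrite mulrA mulfV ?pnatr_eq0 // mul1r -scalerAr; congr (_ *: _).
exact: mulrC.
Qed.

Lemma bin_at_recl j z : j.+1%:R * bin_at j.+1 z = z * bin_at j (z - 1).
Proof.
rewrite !bin_atE big_ord_recl /= natr_poly mul_polyC scalerA factS natrM invfM.
rewrite mulrA mulfV ?pnatr_eq0 // mul1r -scalerAr subr0; congr (_ *: (_ * _)).
by apply: eq_bigr => i _; rewrite bump0 -addrA -opprD -natr1 [1 + _]addrC.
Qed.

Lemma bin_at_add1 j z : bin_at j.+1 (z + 1) = bin_at j.+1 z + bin_at j z.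
Proof.
apply: (mulfI (natrS_poly_neq0 j)).
rewrite bin_at_recl addrK mulrDr bin_at_recr -mulrDl.
by congr (_ * _); rewrite -natr1; ring.
Qed.

(** The argument is itself a polynomial, so that one set of recurrences serves x, x + j, -x and -x -
    1. *)
Definition ch b n z : {poly R} := charlier b n \Po z.

Lemma ch_comp b n z y : ch b n z \Po y = ch b n (z \Po y).
Proof. by rewrite /ch comp_polyA. Qed.

(** The right-hand side is the coefficient of t^n in exp(-bt)(1+t)^z. *)
Lemma chE b n z :
  ch b n z = \sum_(j < n.+1) ((- b) ^+ (n - j) / (n - j)`!%:R) *: bin_at j z.
Proof.
rewrite /ch /charlier comp_polyZ raddf_sum scaler_sumr; apply: eq_bigr => j _.
rewrite /= comp_polyZ scalerA; congr (_ *: _).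
have jn : (j <= n)%N by rewrite -ltnS.
have F0 i : (i`!%:R : R) != 0 by rewrite pnatr_eq0 -lt0n fact_gt0.
have := bin_fact jn => /(congr1 (fun i => i%:R : R)) /esym.
rewrite !natrM => ->.
have B0 : ('C(n, j)%:R : R) != 0 by rewrite pnatr_eq0 -lt0n bin_gt0.
by field; rewrite !F0.
Qed.

Lemma ch0 b z : ch b 0%N z = 1.
Proof. by rewrite chE big_ord1 subnn expr0 divr1 scale1r bin_at0. Qed.

(** The d-th forward difference of c_n at z, which is c_{n-d}(z) with members of negative index read
    as 0. *)
Definition chs b n d z : {poly R} := if (d <= n)%N then ch b (n - d) z else 0.

Lemma chs0 b n z : chs b n 0%N z = ch b n z.
Proof. by rewrite /chs subn0. Qed.

Lemma chsSS b n d z : chs b n.+1 d.+1 z = chs b n d z.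
Proof. by rewrite /chs ltnS subSS. Qed.

Lemma ch_add1 b n z : ch b n (z + 1) = ch b n z + chs b n 1 z.
Proof.
case: n => [|n]; first by rewrite /chs !ch0 addr0.
rewrite chsSS chs0 !chE big_ord_recl [in RHS]big_ord_recl /= !bin_at0 -addrA.
congr (_ + _); rewrite -big_split; apply: eq_bigr => j _.
by rewrite bump0 bin_at_add1 scalerDr subSS.
Qed.

Lemma chs_add1 b n d z : chs b n d (z + 1) = chs b n d z + chs b n d.+1 z.
Proof.
rewrite /chs; case: (leqP d n) => [dn|nd]; last by rewrite ifF ?addr0 //; lia.
rewrite ch_add1 /chs subn_gt0; case: ifP => // _; by rewrite -subnDA addn1.
Qed.

(** This is the t-derivative of exp(-bt)(1+t)^z, read off coefficientwise: in [chE] the factor n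
    splits as (n-j) + j, the first part lowering the power of b and the second the binomial. *)
Lemma ch_rec b n z :
  n%:R * ch b n z = z * chs b n 1 (z - 1) - b%:P * chs b n 1 z.
Proof.
case: n => [|n]; first by rewrite /chs mul0r !mulr0 subr0.
rewrite !chsSS !chs0 chE mulr_sumr.
have E (j : 'I_n.+2) : n.+1%:R = (n.+1 - j)%:R + j%:R :> {poly R}.
  by rewrite -natrD subnK // -ltnS.
under eq_bigr => j _ do rewrite (E j) mulrDl.
rewrite big_split /= big_ord_recr /= subnn mul0r addr0.
rewrite [X in _ + X]big_ord_recl /= mul0r add0r addrC; congr (_ + _).
  rewrite chE mulr_sumr; apply: eq_bigr => j _.
  by rewrite bump0 subSS -!scalerAr bin_at_recl.
rewrite chE mulr_sumr -sumrN; apply: eq_bigr => j _.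
have jn : (j <= n)%N by rewrite -ltnS.
rewrite subSn // natr_poly mul_polyC scalerA mul_polyC scalerA -scaleNr.
congr (_ *: _); rewrite exprS factS natrM invfM.
have F0 : ((n - j)`!%:R : R) != 0 by rewrite pnatr_eq0 -lt0n fact_gt0.
have F1 : ((n - j).+1%:R : R) != 0 by rewrite pnatr_eq0.
by field; rewrite F0 nat1r F1.
Qed.

Lemma ch_diffeq b n z :
  n%:R * ch b n z
  = - z * ch b n (z - 1) + (z + b%:P) * ch b n z - b%:P * ch b n (z + 1).
Proof.
rewrite ch_rec ch_add1.
have -> : ch b n z = ch b n (z - 1) + chs b n 1 (z - 1).
  by rewrite -ch_add1 subrK.
ring.
Qed.

(** Multiplication of the generating function by (1+t)^j, in the form that [detf_pascal] takes as
    hypothesis. *)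
Lemma ch_addn b n z j :
  ch b n (z + j%:R) = \sum_(l < j.+1) 'C(j, l)%:R * chs b n l z.
Proof.
suff E d : chs b n d (z + j%:R) = \sum_(l < j.+1) 'C(j, l)%:R * chs b n (d + l) z.
  by rewrite -chs0 E.
elim: j d => [|j IH] d.
  by rewrite big_ord1 addr0 addn0 mul1r.
rewrite -natr1 addrA chs_add1 !IH [RHS]big_ord_recl /= bin0 addn0.
rewrite [X in X + _]big_ord_recl /= bin0 addn0 -addrA; congr (_ + _).
rewrite big_ord_recr [in RHS]big_ord_recr /= !binn [X in _ = X + _]
  (eq_bigr (fun i : 'I_j => 'C(j, i.+1)%:R * chs b n (d + i.+1) z
     + 'C(j, i)%:R * chs b n (d.+1 + i) z)).
  by rewrite big_split /= -!addrA addSnnS.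
by move=> i _; rewrite bump0 binS natrD mulrDl addSnnS.
Qed.

Lemma horner_ch0 b n : (charlier b n).[0] = (- b) ^+ n / n`!%:R.
Proof.
elim: n => [|n IH].
  have := ch0 b 'X; rewrite /ch comp_polyXr => ->.
  by rewrite hornerC expr0 divr1.
have /(congr1 (horner^~ 0)) := ch_rec b n.+1 'X.
rewrite !chsSS !chs0 natr_poly hornerD hornerN !hornerM !hornerC hornerX mul0r add0r.
rewrite /ch !comp_polyXr IH => /(canRL (mulKf _)) ->; last by rewrite pnatr_eq0.
rewrite exprS factS natrM.
have F0 : (n`!%:R : R) != 0 by rewrite pnatr_eq0 -lt0n fact_gt0.
have F1 : (n.+1%:R : R) != 0 by rewrite pnatr_eq0.
by field; rewrite F0 nat1r F1.
Qed.

(** If c_{n+1} vanished, so would its forward difference c_n. *)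
Lemma ch_neq0 b n : ch b n 'X != 0 .
Proof.
rewrite /ch comp_polyXr; elim: n => [|n IH].
  by have := ch0 b 'X; rewrite /ch comp_polyXr => ->; rewrite oner_neq0.
apply: contraNneq IH => E.
have := ch_add1 b n.+1 'X; rewrite chsSS chs0 /ch !comp_polyXr E comp_poly0 add0r.
by move=> <-.
Qed.

(** Writing r+g = (r+l) + (g-l) and applying [ch_rec] to each factor makes the sum telescope. With r
    = 0 the right-hand side vanishes, which yields the inverse Toeplitz matrix; with r replaced by
    r+1 this is the formula for [kappa]. *)
Lemma ch_conv b r g z :
  (r + g)%:R * \sum_(l < g.+1) ch b (r + l) z * ch (- b) (g - l) (- z)
  = z * chs b r 1 (z - 1) * ch (- b) g (- z - 1)
    - b%:P * chs b r 1 z * ch (- b) g (- z).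
Proof.
set A := ch b; set B := ch (- b); set B1 := chs (- b).
pose U l := chs b (r + l) 1 (z - 1) * B (g - l)%N (- z - 1).
pose V l := chs b (r + l) 1 z * B (g - l)%N (- z).
have E l : (l < g)%N ->
    (r + g)%:R * (A (r + l)%N z * B (g - l)%N (- z))
    = z * (U l - U l.+1) - b%:P * (V l - V l.+1).
  move=> lg; have -> : (r + g)%:R = (r + l)%:R + (g - l)%:R :> {poly R}.
    by rewrite -natrD -addnA subnKC // ltnW.
  rewrite mulrDl mulrA ch_rec -/A mulrCA ch_rec polyCN -/B1.
  rewrite /U /V !addnS !chsSS !chs0 -/A.
  rewrite -(subnSK lg) /B1 !chsSS !chs0 -/B.
  have -> : A (r + l)%N z = A (r + l)%N (z - 1) + chs b (r + l) 1 (z - 1).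
    by rewrite -ch_add1 subrK.
  have -> : B (g - l.+1).+1 (- z) = B (g - l.+1).+1 (- z - 1) + B (g - l.+1)%N (- z - 1).
    by rewrite /B -[in LHS](subrK 1 (- z)) ch_add1 chsSS chs0.
  ring.
rewrite big_ord_recr /= mulrDr mulr_sumr.
under eq_bigr => l _ do rewrite E ?ltn_ord //.
rewrite sumrB -!mulr_sumr.
have tel (f : nat -> {poly R}) n : \sum_(l < n) (f l - f l.+1) = f 0%N - f n.
  elim: n => [|n IH]; first by rewrite big_ord0 subrr.
  by rewrite big_ord_recr /= IH addrA subrK.
rewrite !tel /U /V !addn0 !subn0 subnn /B /A !ch0 !mulr1 ch_rec.
ring.
Qed.
End CharlierPolynomials.

(** * The involution *)

Section Involution.
Local Open Scope nat_scope.
Implicit Types F D : seq nat.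

Lemma sum_sorted_ge x F :
  path ltn x F -> (size F * x + 'C((size F).+1, 2) <= \sum_(f <- F) f)%N.
Proof.
elim: F x => [|y F IH] x /=; first by rewrite big_nil bin_small.
move=> /andP[xy /IH H]; rewrite big_cons binS bin1; move: H xy => /=; nia.
Qed.

Lemma nth_sorted_ge F j : sorted ltn F -> all (fun f => 0 < f)%N F ->
  (j < size F)%N -> (j < nth 0 F j)%N.
Proof.
move=> sF pF; elim: j => [|j IH] jF; first by move/all_nthP: pF; apply.
apply: leq_ltn_trans (IH (ltnW jF)) _.
by apply: (sorted_ltn_nth ltn_trans) => //; rewrite inE ltnW.
Qed.

Lemma last_sorted_ge F f : sorted ltn F -> f \in F -> (f <= last 0 F)%N.
Proof.
move=> sF /(nthP 0)[i iF <-]; rewrite -nth_last.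
by apply: (sorted_leq_nth leq_trans leqnn); rewrite ?inE //;
  [apply: sub_sorted sF => ? ? /ltnW | case: F {sF} iF | case: F {sF} iF].
Qed.

Lemma involE F : invol F
  = [seq g <- iota 1 (last 0 F) | g \notin [seq last 0 F - f | f <- F]].
Proof. by []. Qed.

Lemma mem_invol F g : sorted ltn F ->
  (g \in invol F) = (0 < g <= last 0 F) && (last 0 F - g \notin F).
Proof.
move=> sF; rewrite involE mem_filter mem_iota add1n ltnS andbC.
case gl: (0 < g <= last 0 F) => //=; congr (~~ _).
apply/mapP/idP => [[f fF ->]|H]; last first.
  by exists (last 0 F - g) => //; rewrite subKn //; case/andP: gl.
by rewrite subKn // last_sorted_ge.
Qed.

Lemma invol_sorted F : sorted ltn (invol F).
Proof. by rewrite sorted_filter ?iota_ltn_sorted //; exact: ltn_trans. Qed.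

(** F and the reflection of I(F) in f_k partition {0, ..., f_k}; this is the complementarity
    required by Jacobi's theorem. *)
Lemma invol_perm F : F != [::] -> sorted ltn F -> all (fun f => 0 < f) F ->
  perm_eq (F ++ [seq last 0 F - g | g <- invol F]) (iota 0 (last 0 F).+1).
Proof.
move=> F0 sF pF; set q := last 0 F.
have uF := sorted_uniq ltn_trans ltnn sF.
have uG := sorted_uniq ltn_trans ltnn (invol_sorted F).
have GP g : g \in invol F -> 0 < g <= q by rewrite mem_invol // => /andP[].
apply: uniq_perm; rewrite ?iota_uniq //.
  rewrite cat_uniq uF; apply/and3P; split=> //.
    apply/hasPn => x /mapP[g gG ->]; move: gG; rewrite mem_invol // => /andP[_].
    by [].
  rewrite map_inj_in_uniq // => g h /GP gP /GP hP; lia.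
move=> x; rewrite mem_cat mem_iota add0n ltnS /=.
apply/orP/idP => [[xF|/mapP[g _ ->]]|xq]; first exact: last_sorted_ge.
  exact: leq_subr.
case xF: (x \in F); first by left.
right; apply/mapP; exists (q - x); last by lia.
rewrite mem_invol // -/q subKn // xF leq_subr !andbT subn_gt0 ltn_neqAle xq andbT.
apply: contraFN xF => /eqP ->; rewrite /q; case: F F0 {sF pF uF uG GP q xq} => // f F _.
exact: mem_last.
Qed.

Lemma size_invol F : F != [::] -> sorted ltn F -> all (fun f => 0 < f) F ->
  size F + size (invol F) = (last 0 F).+1.
Proof.
by move=> F0 sF pF; have /perm_size := invol_perm F0 sF pF;
  rewrite size_cat size_map size_iota.
Qed.

(** The subtraction in [uF] is therefore exact. *)
Lemma uF_geq F : sorted ltn F -> all (fun f => 0 < f) F ->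
  'C((size F).+1, 2) <= \sum_(f <- F) f.
Proof.
move=> sF pF; have := @sum_sorted_ge 0 F; rewrite muln0 add0n; apply.
by case: F sF pF => //= f F ->/andP[->].
Qed.

(** Sum the partition of [invol_perm]; the form without subtraction suits linear arithmetic. *)
Lemma uF_invol F : sorted ltn F -> all (fun f => 0 < f) F ->
  uF F + size F + 'C(size (invol F), 2) = \sum_(g <- invol F) g.
Proof.
case F0 : (F == [::]); first by rewrite (eqP F0) uF_nil /= !big_nil.
move/negbT: F0 => F0 sF pF.
have := size_invol F0 sF pF; have := uF_geq sF pF; rewrite /uF.
have E : \sum_(x <- F ++ [seq last 0 F - g | g <- invol F]) x
    = \sum_(x <- iota 0 (last 0 F).+1) x by exact/perm_big/invol_perm.
rewrite big_cat big_map /= in E.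
have GP g : g \in invol F -> g <= last 0 F.
  by rewrite mem_invol // => /andP[/andP[]].
have {E} : \sum_(f <- F) f + size (invol F) * last 0 F
    = 'C((last 0 F).+1, 2) + \sum_(g <- invol F) g.
  rewrite -bin2_sum /index_iota subn0 -[X in _ = X + _]E -addnA; congr (_ + _).
  rewrite -big_split /= -sum1_size big_distrl /= big_seq [RHS]big_seq.
  by apply: eq_bigr => g /GP gq; rewrite mul1n subnK.
rewrite binS bin1; move: (\sum_(g <- invol F) g) (\sum_(f <- F) f).
move: (size F) (size (invol F)) (last 0 F) => k m q s t.
(* With this the triangular numbers enter the arithmetic only through squares. *)
have H n : 'C(n, 2) + 'C(n, 2) + n = n * n.
  by elim: n => // n IH; rewrite binS bin1; lia.
have := H k; have := H m; have := H q; rewrite binS bin1.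
move: 'C(k, 2) 'C(m, 2) 'C(q, 2) => a b c; nia.
Qed.

Lemma vF_uF F : F != [::] -> sorted ltn F -> all (fun f => 0 < f) F ->
  vF F = (uF F + last 0 F).+1.
Proof.
move=> F0 sF pF; have := uF_geq sF pF; rewrite /vF /uF; case: F F0 {sF pF} => // f F _.
have H n : 'C(n, 2) + 'C(n, 2) + n = n * n.
  by elim: n => // n IH; rewrite binS bin1; lia.
move=> H1.
have -> : (size (f :: F)).-1 * (size (f :: F) + 2) = ('C((size (f :: F)).+1, 2).-1) * 2.
  move: (H (size (f :: F)).+1) => /=; nia.
have : 0 < 'C((size (f :: F)).+1, 2) by rewrite bin_gt0.
by rewrite mulnK //; move: H1; rewrite -/(last 0 (f :: F)); lia.
Qed.

(** Here s is the least positive integer missing from F: F starts with 1, ..., s-1, and the rest [D]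
    lies beyond s. *)
Lemma down_cat F : sorted ltn F -> all (fun f => 0 < f) F ->
  F != iota 1 (size F) ->
  exists s D, [/\ 0 < s, D != [::], all (fun f => s < f) D, F = iota 1 s.-1 ++ D
    & down F = [seq f - s | f <- D]].
Proof.
move=> sF pF ne; set a := fun s => s < nth 0 F s.-1.
have hs : has a (iota 1 (size F)).
  apply: contraNT ne => /hasPn H; apply/eqP/(@eq_from_nth _ 0).
    by rewrite size_iota.
  move=> i iF; rewrite nth_iota // add1n; apply/eqP; rewrite eqn_leq nth_sorted_ge //.
  by have := H i.+1; rewrite mem_iota /a -leqNgt andbT add1n !ltnS leq0n iF; apply.
set i := find a (iota 1 (size F)).
have iF : i < size F by rewrite -[size F](size_iota 1) -has_find.
have ai : i.+1 < nth 0 F i.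
  by have := nth_find 0 hs; rewrite -/i nth_iota //.
have dropi : drop i F = nth 0 F i :: drop i.+1 F by rewrite -drop_nth.
exists i.+1, (drop i F); split => //.
- by rewrite dropi.
- rewrite dropi /= ai; have := drop_sorted i sF; rewrite dropi /= path_sortedE;
    last exact: ltn_trans.
  by case/andP => /allP H _; apply/allP => x /H; exact: ltn_trans.
- rewrite /= -[LHS](cat_take_drop i); congr (_ ++ _); apply: (@eq_from_nth _ 0).
    by rewrite size_iota size_takel // ltnW.
  move=> j; rewrite size_takel ?(ltnW iF) // => ji.
  rewrite nth_take // nth_iota // add1n; apply/eqP.
  rewrite eqn_leq nth_sorted_ge ?(ltn_trans ji) // andbT.
  have := @before_find _ 0 a (iota 1 (size F)) j ji.
  by rewrite nth_iota ?(ltn_trans ji) // add1n /a /= ltnNge => /negbFE.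
- by rewrite /down (negbTE ne).
Qed.

Lemma down_sorted F : sorted ltn F -> all (fun f => 0 < f) F ->
  sorted ltn (down F) /\ all (fun f => 0 < f) (down F).
Proof.
move=> sF pF; case: (eqVneq F (iota 1 (size F))) => [E|/(down_cat sF pF)].
  by rewrite /down -E eqxx.
case=> s [D [s0 _ Ds FE ->]]; split.
  rewrite sorted_map; have := drop_sorted (size (iota 1 s.-1)) sF.
  rewrite [in X in drop _ X]FE drop_size_cat // => sD.
  apply: (@sub_in_sorted _ (fun f => s < f) ltn _ _ D Ds sD) => x y.
  by rewrite !unfold_in /= => sx sy xy; lia.
by rewrite all_map; apply: sub_all Ds => f /=; rewrite subn_gt0.
Qed.

(** With q = f_k, g belongs to I(F) when q-g is not in F. The value g = q qualifies because 0 is not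
    in F; for q-s < g < q the difference lies in the initial run 1, ..., s-1 of F; for g <= q-s the
    condition is that of F_down, whose largest element is q-s. *)
Lemma invol_down F : F != [::] -> sorted ltn F -> all (fun f => 0 < f) F ->
  invol F = rcons (invol (down F)) (last 0 F).
Proof.
move=> F0 sF pF; have [sdF pdF] := down_sorted sF pF.
have q0 : 0 < last 0 F.
  by case: F F0 sF pF {sdF pdF} => // f F _ _ /allP; apply; exact: mem_last.
set q := last 0 F.
have [ltq memq] : (forall g, g \in invol (down F) -> g < q)
  /\ (forall g, (g \in invol F) = (g == q) || (g \in invol (down F))).
  case: (eqVneq F (iota 1 (size F))) => [E|/(down_cat sF pF)].
    have -> : down F = [::] by rewrite /down -E eqxx.
    split=> // g; rewrite mem_invol // orbF -/q.
    have -> : q = size F.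
      rewrite /q -nth_last {1}E nth_iota; last by case: F F0 {sF pF E q sdF pdF q0}.
      by case: F F0 {sF pF E q sdF pdF q0}.
    have memF x : (x \in F) = (0 < x <= size F) by rewrite {1}E mem_iota.
    rewrite memF; case: (eqVneq g (size F)) => [->|ne]; last by lia.
    by have : 0 < size F; [rewrite lt0n size_eq0 | lia].
  case=> s [D [s0 D0 /allP Ds FE dE]].
  have qD : q = last 0 D by rewrite /q FE last_cat; case: D D0 {Ds FE dE}.
  have qs : s < q by rewrite qD; apply: Ds; case: D D0 {FE dE qD} => //= *; exact: mem_last.
  have lastd : last 0 (down F) = q - s.
    rewrite dE qD; case: D D0 {Ds FE dE qD} => //= d D _.
    by rewrite (last_map (fun f => f - s)).
  split=> g; rewrite !mem_invol // lastd -?/q; first by lia.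
  have memF x : (x \in F) = (0 < x < s) || (x \in D).
    by rewrite {1}FE mem_cat mem_iota; congr (_ || _); lia.
  have -> : (q - s - g \in down F) = (q - s - g + s \in D).
    rewrite dE; apply/mapP/idP => [[x xD ->]|xD]; first by rewrite subnK // ltnW ?Ds.
    by exists (q - s - g + s) => //; rewrite addnK.
  rewrite memF; case: (eqVneq g q) => [->|ne].
    rewrite subnn /= q0 leqnn /=; apply/negP => /Ds; lia.
  have [gs|gs] := leqP g (q - s); last by lia.
  have -> : q - s - g + s = q - g by lia.
  by rewrite /=; lia.
apply: (irr_sorted_eq ltn_trans ltnn (invol_sorted F)).
  rewrite (sorted_pairwise ltn_trans) pairwise_rcons -(sorted_pairwise ltn_trans).
  by rewrite invol_sorted andbT; apply/allP => g /ltq.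
by move=> g; rewrite mem_rcons inE memq.
Qed.
Lemma size_invol_down (F : seq nat) : F != [::] -> sorted ltn F -> all (fun f => 0 < f) F ->
  (size F + size (invol (down F)) = last 0 F).
Proof.
move=> F0 sF pF; have := size_invol F0 sF pF.
by rewrite invol_down // size_rcons addnS => -[].
Qed.

Lemma uF_down (F : seq nat) : F != [::] -> sorted ltn F -> all (fun f => 0 < f) F ->
  (size (down F) + uF (down F) = uF F).
Proof.
move=> F0 sF pF; have [sF' pF'] := down_sorted sF pF.
have := uF_invol sF pF; have := uF_invol sF' pF'; have := size_invol_down F0 sF pF.
by rewrite (invol_down F0) // size_rcons -cats1 big_cat big_seq1 binS bin1 /=; lia.
Qed.

(** The same r serves both polynomials of the third claim: in each, the index of the first row
    exceeds the largest element of the set by r+1, or is r itself when the set is empty. This is the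
    index hypothesis of [cF_mixed]. *)
Lemma down_index (F : seq nat) n (r := (n - vF F)) :
  F != [::] -> sorted ltn F -> all (fun f => 0 < f) F -> (vF F <= n) ->
  (n - uF F = (last 0 F).+1 + r)
  /\ (n - size F - 1 - uF (down F)
      = if down F == [::] then r else (last 0 (down F)).+1 + r).
Proof.
move=> F0 sF pF; rewrite /r vF_uF // => vn; split; first by lia.
have := uF_down F0 sF pF; have := size_invol_down F0 sF pF.
have [sF' pF'] := down_sorted sF pF.
case: eqVneq => [->|F'0]; first by rewrite uF_nil /=; lia.
by have := size_invol F'0 sF' pF'; lia.
Qed.

End Involution.

(** * Duality *)

Section Duality.
Variable R : realType.
Implicit Types (a b : R) (z : {poly R}) (F G : seq nat).

Lemma chs_inv a n i l z : (i < n)%N ->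
  \sum_(j < n) chs a i j z * chs (- a) j l (- z) = (i == l)%:R.
Proof.
move=> ilt.
have [li|il] := leqP l i; last first.
  rewrite big1 ?ltn_eqF // => j _; rewrite /chs.
  by case: leqP => [ji|]; rewrite ?mul0r // ifF ?mulr0 //; lia.
rewrite -(big_mkord xpredT (fun j => chs a i j z * chs (- a) j l (- z))).
rewrite (big_cat_nat (n := l)) //=; last by lia.
rewrite big_nat big1 ?add0r; last first.
  by move=> j /andP[_ jl]; rewrite [chs (- a) _ _ _]/chs ifF ?mulr0 //; lia.
rewrite (big_cat_nat (n := i.+1)) //=; last by lia.
rewrite [X in _ + X]big_nat [X in _ + X]big1 ?addr0; last first.
  by move=> j /andP[ij _]; rewrite [chs a _ _ _]/chs ifF ?mul0r //; lia.
rewrite -[l in \sum_(l <= _ < _) _]add0n big_addn big_mkord subSn //.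
(* At r = 0 both terms on the right vanish, so i-l times the convolution is 0; only i = l
   survives. *)
have := ch_conv (- a) 0 (i - l) (- z); rewrite !opprK add0n.
rewrite [chs (- a) 0 1 _]/chs [chs (- a) 0 1 _]/chs !mulr0 !mul0r subrr.
under eq_bigr => t _ do rewrite add0n.
have -> : \sum_(t < (i - l).+1) ch (- a) t (- z) * ch a (i - l - t) z
    = \sum_(t < (i - l).+1) chs a i (t + l) z * chs (- a) (t + l) l (- z).
  apply: eq_bigr => t _; have := ltn_ord t; rewrite ltnS => tl.
  rewrite /chs leq_addl addnK ifT; last by lia.
  by rewrite mulrC addnC subnDA.
have [->|ne] := eqVneq i l; last first.
  move=> /eqP; rewrite mulf_eq0 natr_poly polyC_eq0 pnatr_eq0 => /orP[|/eqP//].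
  by lia.
by move=> _; rewrite subnn big_ord1 add0n /chs leqnn subnn !ch0 mulr1.
Qed.

(** A minor of the Toeplitz matrix of the c_n; by [OmegaE] it is Omega_F at z = x. *)
Definition toep b F z : {poly R} := detf (size F) (fun i j => chs b (nth 0%N F i) j z).

(** Jacobi's theorem for the Toeplitz matrix enlarged by a free row [eta]. Unit vectors for [eta]
    give Omega_F and its gapped variant, a row of Charlier polynomials gives c_n^F. The sign is
    independent of [a], [z] and [eta]. *)
Lemma dual_minor F (q := last 0%N F) (k := size F) (G := invol F) (m := size G) :
  F != [::] -> sorted ltn F -> all (fun f => 0 < f)%N F ->
  exists e : bool, forall a z (eta : nat -> {poly R}),
    detf k.+1 (fun i j => if i is i'.+1 then chs a (nth 0%N F i') j z else eta j)
    = (-1) ^+ e * detf m (fun i j =>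
        if j is j'.+1 then chs (- a) (nth 0%N G i) j' (- z)
        else \sum_(b < q.+1) eta (q - b)%N * chs (- a) (nth 0%N G i) b (- z)).
Proof.
move=> F0 sF pF.
have mk : (k + m)%N = q.+1 := size_invol F0 sF pF.
have qF : q \in F by rewrite /q; case: (F) F0 => // f F' _; exact: mem_last.
have q0 : (0 < q)%N by move/allP: pF; apply.
have kq : (k <= q)%N.
  by have := @nth_sorted_ge F k.-1 sF pF; rewrite nth_last -/q /k;
     case: (F) F0 => //= f F' _; apply.
have GP g : g \in G -> (g <= q)%N by rewrite mem_invol // => /andP[/andP[]].
(* The extra index q+1 carries the row [eta]. It is a chosen row of [L] but not a chosen column, so
   in the complementary minor of [V] it is a row, which becomes the convolution column after
   transposition. *)
pose r1 := q.+1 :: F; pose r2 := [seq (q - g)%N | g <- G].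
pose c1 := iota 0 k.+1; pose c2 := q.+1 :: [seq (q - t)%N | t <- iota 0 m.-1].
have m0 : (0 < m)%N by lia.
have [] := @detf_compl {poly R} k.+1 m r1 r2 c1 c2.
- by [].
- by rewrite size_iota.
- by rewrite size_map.
- by rewrite /= size_map size_iota prednK.
- rewrite addSn mk -[q.+2]addn1 iotaD add0n perm_sym perm_catC perm_sym.
  by have := invol_perm F0 sF pF; rewrite -(perm_cons q.+1).
- rewrite addSn mk; apply: uniq_perm; rewrite ?iota_uniq //.
    rewrite cat_uniq iota_uniq; apply/and3P; split=> //.
      apply/hasPn => x; rewrite inE mem_iota => /orP[/eqP ->|/mapP[t]]; first by lia.
      by rewrite mem_iota => tm ->; lia.
    rewrite cons_uniq; apply/andP; split.
      by apply/negP => /mapP[t]; rewrite mem_iota; lia.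
    by rewrite map_inj_in_uniq ?iota_uniq // => t t'; rewrite !mem_iota; lia.
  move=> x; rewrite mem_cat inE !mem_iota.
  apply/idP/idP => [/or3P[| |/mapP[b]]|]; rewrite ?mem_iota; try lia.
  move=> xq; have [xk|xk] := leqP x k; first by apply/orP; left; lia.
  have [xq1|xq1] := eqVneq x q.+1; first by rewrite xq1 inE eqxx orbT.
  apply/orP; right; apply/orP; right; apply/mapP; exists (q - x)%N; last by lia.
  by rewrite mem_iota; lia.
(* The sign is flipped because row q+1 of the inverse [V] is minus the convolution of [eta]. *)
move=> e E; exists (~~ e) => a z eta.
pose L i j := if i == q.+1 then (if j == q.+1 then 1 else if (j <= q)%N then eta j else 0)
  else chs a i j z.
pose V j l := if l == q.+1 then (j == q.+1)%:R else
  if j == q.+1 then - \sum_(c < q.+1) eta c * chs (- a) c l (- z)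
  else chs (- a) j l (- z).
have {E} := E L V.
have -> : detf k.+1 (fun i j => L (nth 0%N r1 i) (nth 0%N c1 j)) =
  detf k.+1 (fun i j => if i is i'.+1 then chs a (nth 0%N F i') j z else eta j).
  apply: eq_detf => [[|i]] j ik jk; rewrite /= nth_iota // add0n /L.
    by rewrite eqxx ltn_eqF ?ifT //; lia.
  rewrite ltn_eqF // ltnS /q; apply: last_sorted_ge => //.
  by rewrite mem_nth.
move=> -> //.
- rewrite -detf_tr.
  pose g i j := if j is j'.+1 then chs (- a) (nth 0%N G i) j' (- z)
        else \sum_(b < q.+1) eta (q - b)%N * chs (- a) (nth 0%N G i) b (- z).
  have qg i (b : nat) : (i < m)%N -> (b <= q)%N ->
      chs (- a) (q - b) (nth 0%N r2 i) (- z) = chs (- a) (nth 0%N G i) b (- z).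
    move=> im bq; rewrite (nth_map 0%N) //.
    have := GP _ (mem_nth 0%N im); set x := nth _ _ _ => xq.
    rewrite /chs; congr (if _ then ch _ _ _ else _); lia.
  rewrite signrN mulNr -/g.
  have -> : detf m (fun i j => V (nth 0%N c2 j) (nth 0%N r2 i)) = - detf m g.
    rewrite -(prednK m0) -mulN1r.
    transitivity (detf m.-1.+1 (fun i j => if j == 0%N then - g i 0%N else g i j)).
      apply: eq_detf => i j im jm; rewrite prednK // in im jm.
      have ri : (nth 0%N r2 i <= q)%N by rewrite (nth_map 0%N) ?leq_subr.
      rewrite /V ifF; last by lia.
      case: j jm => [|j] jm /=.
        rewrite eqxx; congr (- _); rewrite (reindex_inj rev_ord_inj) /=.
        by apply: eq_bigr => b _; rewrite subSS qg // -ltnS.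
      rewrite (nth_map 0%N) ?size_iota; last by lia.
      rewrite nth_iota; last by lia.
      by rewrite add0n ifF ?qg //; lia.
    rewrite detf_col //; have := cof_col g (ltn0Sn m.-1) (ltn0Sn m.-1).
    rewrite eqxx mul1r => <-; rewrite mulr_sumr.
    by apply: eq_bigr => i _; rewrite mulN1r mulNr.
  by rewrite mulrN.
- move=> i j ij; rewrite /L; case: eqP => [E|_].
    by rewrite !ifF //; lia.
  by rewrite /chs ifF //; lia.
- move=> i; rewrite /L; case: eqP => // _.
  by rewrite /chs leqnn subnn ch0.
move=> i l; rewrite addSn mk => iq lq; rewrite big_ord_recr /=.
rewrite {2}/V; case: (eqVneq l q.+1) => [->|lne].
  rewrite eqxx mulr1 big1 ?add0r; last first.
    by move=> j _; rewrite /V eqxx ltn_eqF ?mulr0.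
  rewrite /L eqxx; case: eqP => // /eqP ne; rewrite /chs ifF //; lia.
rewrite eqxx.
under eq_bigr => j _ do rewrite /V (negbTE lne) (ltn_eqF (ltn_ord j)).
rewrite /L eqxx; case: (eqVneq i q.+1) => [->|ine].
  under eq_bigr => j _ do rewrite (ltn_eqF (ltn_ord j)) -ltnS ltn_ord.
  by rewrite mul1r subrr eq_sym (negbTE lne).
rewrite chs_inv; last by lia.
by rewrite [chs a i _ _]/chs ifF ?mul0r ?addr0 //; lia.
Qed.

Definition toep_up b F z : {poly R} :=
  detf_up (size F) (fun i j => chs b (nth 0%N F i) j z).

(** At 0 the entries are (-b)^(f-j)/(f-j)!, that is, f(f-1)...(f-j+1) up to a row factor (-b)^f/f!
    and a column factor (-b)^(-j); [detf_ffact_gt0] applies. This fixes the sign in the duality and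
    shows that the Casoratians do not vanish. *)
Lemma toep_at0 b F z : b != 0 -> z.[0] = 0 -> sorted ltn F ->
  exists2 v : R, 0 < v &
    (toep b F z).[0] = (- b) ^+ (\sum_(f <- F) f) / (- b) ^+ 'C(size F, 2) * v.
Proof.
move=> b0 z0 sF.
pose v := (\prod_(i < size F) ((nth 0%N F i)`!%:R)^-1)
  * detf (size F) (fun i j => (nth 0%N F i ^_ j)%:R : R).
exists v.
  apply: mulr_gt0; last exact: detf_ffact_gt0.
  by rewrite prodr_gt0 // => i _; rewrite invr_gt0 ltr0n fact_gt0.
pose r i := (- b) ^+ (nth 0%N F i) * ((nth 0%N F i)`!%:R)^-1 : R.
rewrite /toep -/(horner_eval 0 _) rmorph_detf /= /horner_eval.
rewrite (@eq_detf _ _ _ (fun i j => r i * (nth 0%N F i ^_ j)%:R * (- b)^-1 ^+ j)).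
  rewrite detf_scale /r big_split /= /v -exprVn.
  rewrite -bin2_sum big_mkord -expr_sum (big_nth 0%N) big_mkord -expr_sum; ring.
move=> i j _ _; rewrite /r /chs; set f := nth 0%N F i.
case: (leqP j f) => jf; last by rewrite horner0 ffact_small // mulr0 mul0r.
rewrite /ch horner_comp z0 horner_ch0.
have := ffact_fact jf => /(congr1 (fun n => n%:R : R)); rewrite natrM => <-.
have f0 : ((f - j)`!%:R : R) != 0 by rewrite pnatr_eq0 -lt0n fact_gt0.
have f1 : ((f ^_ j)%:R : R) != 0 by rewrite pnatr_eq0 -lt0n ffact_gt0.
have -> : (- b) ^+ f = (- b) ^+ (f - j) * (- b) ^+ j by rewrite -exprD subnK.
rewrite exprVn; have {}b0 : (- b) ^+ j != 0 by rewrite expf_neq0 // oppr_eq0.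
by field; rewrite f0 f1 b0.
Qed.

Definition bordered a F z (eta : nat -> {poly R}) : {poly R} :=
  detf (size F).+1
    (fun i j => if i is i'.+1 then chs a (nth 0%N F i') j z else eta j).

Definition bordered_dual a F z (eta : nat -> {poly R}) : {poly R} :=
  detf (size (invol F)) (fun i j =>
    if j is j'.+1 then chs (- a) (nth 0%N (invol F) i) j' (- z)
    else \sum_(t < (last 0%N F).+1)
           eta (last 0 F - t)%N * chs (- a) (nth 0%N (invol F) i) t (- z)).

Lemma toep_dual F : F != [::] -> sorted ltn F -> all (fun f => 0 < f)%N F ->
  forall a z,
  [/\ toep a F z = (-1) ^+ (uF F + size F) * toep (- a) (invol F) (- z),
      toep_up a F z = - (-1) ^+ (uF F + size F) * toep_up (- a) (invol F) (- z)
    & forall eta, bordered a F z eta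
        = (-1) ^+ (uF F + (size (invol F)).-1) * bordered_dual a F z eta].
Proof.
move=> F0 sF pF; have [e E] := dual_minor F0 sF pF.
have mk := size_invol F0 sF pF.
have GP := @mem_invol F _ sF.
set q := last 0%N F in E mk GP; set k := size F in E mk *.
set G := invol F in E mk GP *; set m := size G in E mk *.
have k0 : (0 < k)%N by rewrite lt0n size_eq0.
have kq : (k <= q)%N.
  by have := @nth_sorted_ge F k.-1 sF pF; rewrite nth_last -/q /k;
     case: (F) F0 => //= f F' _; apply.
(* Take for [eta] the unit vector at c, which deletes column c on the left; c = k gives [toep] and c
   = k-1 gives [toep_up]. *)
have delta a z c : (c <= k)%N ->
    (-1) ^+ c * detf k (fun i j => chs a (nth 0%N F i) (bump c j) z)
    = (-1) ^+ e * (-1) ^+ m.-1 * \sum_(i < m.-1.+1)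
        chs (- a) (nth 0%N G i) (q - c) (- z)
        * cof m.-1 (fun i j => chs (- a) (nth 0%N G i) j (- z)) i m.-1.
  move=> ck; rewrite -(detf_row_delta (fun i j => chs a (nth 0%N F i) j z) ck).
  rewrite (E a z (fun j => (j == c)%:R)) -mulrA.
  rewrite -(detf_first_col m.-1 (fun i j => chs (- a) (nth 0%N G i) j (- z))
    (fun i => chs (- a) (nth 0%N G i) (q - c) (- z))) prednK; last by lia.
  congr (_ * _); apply: eq_detf => i [|j] // im _.
  have qc : (q - c < q.+1)%N by lia.
  rewrite (bigD1 (Ordinal qc)) //= subKn ?(leq_trans ck) // eqxx mul1r big1 ?addr0 //.
  move=> t /eqP ne; rewrite (_ : (_ == _) = false) ?mul0r //; apply/eqP => tc.
  by apply: ne; apply: val_inj => /=; have := ltn_ord t; lia.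
have T a z : toep a F z = (-1) ^+ (e + k + m.-1) * toep (- a) G (- z).
  have := delta a z k (leqnn k).
  rewrite (_ : q - k = m.-1)%N; last by lia.
  pose g i j := chs (- a) (nth 0%N G i) j (- z).
  have := cof_col g (ltnSn m.-1) (ltnSn m.-1); rewrite eqxx mul1r => ->.
  rewrite prednK; last by lia.
  rewrite -/(toep (- a) G (- z)).
  have -> : detf k (fun i j => chs a (nth 0%N F i) (bump k j) z) = toep a F z.
    by apply: eq_detf => i j ik jk; rewrite bump_lt.
  move=> /(canRL (signrMK k)) ->; rewrite !exprD; ring.
have U a z : toep_up a F z = - (-1) ^+ (e + k + m.-1) * toep_up (- a) G (- z).
  rewrite /toep_up -/k -/m -(prednK k0).
  have := delta a z k.-1 (leq_pred k).
  rewrite (_ : q - k.-1 = m.-1.+1)%N; last by lia.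
  rewrite -(detf_upE m.-1 (fun i j => chs (- a) (nth 0%N G i) j (- z))) prednK; last by lia.
  have -> : detf k (fun i j => chs a (nth 0%N F i) (bump k.-1 j) z)
      = detf_up k.-1.+1 (fun i j => chs a (nth 0%N F i) j z).
    rewrite -{1}(prednK k0); apply: eq_detf => i j ik jk.
    rewrite /bump; case: eqP => [->|/eqP ne]; first by rewrite leqnn.
    by rewrite (_ : (_ <= _)%N = false) //; lia.
  move=> /(canRL (signrMK k.-1)) ->; rewrite !(addnS, addSn) !exprS !exprD; ring.
(* Since the sign depends on [F] only, a = 1 and x = 0 decide it: the dual minor is then positive,
   and the other has the sign of (-1) to the sum of F plus binomial(k, 2). *)
have par : odd (e + k + m.-1) = odd (uF F + k).
  have [v v0 Ev] := toep_at0 (oner_neq0 R) (hornerX 0) sF.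
  have [] := @toep_at0 (- 1) _ (- 'X) _ _ (invol_sorted F).
  - by rewrite oppr_eq0 oner_neq0.
  - by rewrite hornerN hornerX oppr0.
  move=> w w0; rewrite opprK !expr1n invr1 !mul1r -/G => Ew.
  have := congr1 (horner^~ 0) (T 1 'X); rewrite Ev invr_sign -exprD.
  have signP n : (-1) ^+ n = (((-1) ^+ n : R)%:P : {poly R}).
    by rewrite rmorphXn /= rmorphN1.
  rewrite signP hornerM hornerC Ew -/k.
  have -> : (\sum_(f <- F) f + 'C(k, 2) = uF F + k + 'C(k, 2).*2)%N.
    have := uF_geq sF pF; rewrite /uF -/k binS bin1; lia.
  have sg n : (-1) ^+ n = (if odd n then -1 else 1) :> R.
    by rewrite -signr_odd; case: odd.
  rewrite exprD !sg odd_double mulr1.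
  by case: (odd (uF F + k)); case: (odd (e + k + m.-1)) => // H; clear -H v0 w0; lra.
have S1 : (-1) ^+ (e + k + m.-1) = (-1) ^+ (uF F + k) :> {poly R}.
  by rewrite -signr_odd par signr_odd.
split; rewrite -?S1 //.
move=> eta; rewrite /bordered E -/(bordered_dual _ _ _ _); congr (_ * _).
rewrite -signr_odd -[RHS]signr_odd; congr (_ ^+ nat_of_bool _).
by move: par; rewrite !oddD; case: (odd e) (odd k) (odd m.-1) (odd (uF F)) => [] [] [] [].
Qed.

End Duality.

(** * Casoratians *)

Section Casoratians.
Variable R : realType.
Implicit Types (a b : R) (z : {poly R}) (F G : seq nat).

Definition cas b G z : {poly R} :=
  detf (size G) (fun i j => ch b (nth 0%N G i) (z + j%:R)).

Definition cas_up b G z : {poly R} :=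
  detf_up (size G) (fun i j => ch b (nth 0%N G i) (z + j%:R)).

Lemma cas_toep b G z : cas b G z = toep b G z.
Proof. by apply: detf_pascal => i j _ _; rewrite ch_addn. Qed.

Lemma cas_up_toep b G z :
  cas_up b G z = toep_up b G z + (size G)%:R * toep b G z.
Proof. by apply: detf_up_pascal => i j _ _; rewrite ch_addn. Qed.

Lemma poly_shiftS z (j : nat) : z + 1 + j%:R = z + j.+1%:R.
Proof. by rewrite -addrA nat1r. Qed.

Lemma cas_rcons_up b G g z :
  cas b (rcons G g) (z + 1) * cas b G z
  = cas_up b (rcons G g) z * cas b G (z + 1)
    - cas_up b G (z + 1) * cas b (rcons G g) z.
Proof.
pose f i j := ch b (nth 0%N (rcons G g) i) (z + j%:R).
have nthG i : (i < size G)%N -> nth 0%N (rcons G g) i = nth 0%N G i.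
  by move=> iG; rewrite nth_rcons iG.
have := detf_plucker_up (size G) f; rewrite /= /cas /cas_up size_rcons => E.
rewrite (@eq_detf _ (size G).+1 _ (fun i j => f i j.+1)); last first.
  by move=> i j _ _; rewrite poly_shiftS.
rewrite (@eq_detf _ (size G) _ f); last first.
  by move=> i j iG _; rewrite /f nthG.
rewrite E; congr (_ * _ - _ * _).
  by apply: eq_detf => i j iG _; rewrite poly_shiftS /f nthG.
case: (size G) nthG => // p nthG; apply: eq_detf => i j iG _.
by rewrite poly_shiftS /f nthG //; case: ifP.
Qed.

(** The relation [detf_plucker_low] based at z-1 involves determinants with a gap after the first
    column. The difference equation, through [detf_derivation], replaces these by [cas_up]; the
    eigenvalue sums of the two sets differ by g, the only index left. *)
Lemma cas_rcons_low b G g z :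
  - z * cas b (rcons G g) (z - 1) * cas b G (z + 1)
  = (g%:R - (z + (size G)%:R + b%:P)) * cas b (rcons G g) z * cas b G z
    + b%:P * cas_up b (rcons G g) z * cas b G z
    - b%:P * cas_up b G z * cas b (rcons G g) z.
Proof.
pose f G i j := ch b (nth 0%N G i) (z - 1 + j%:R).
have fS H i j : ch b (nth 0%N H i) (z + j%:R) = f H i j.+1.
  by rewrite /f -poly_shiftS subrK.
have nthG i : (i < size G)%N -> nth 0%N (rcons G g) i = nth 0%N G i.
  by move=> iG; rewrite nth_rcons iG.
have D H : \sum_(h <- H) h%:R * cas b H z = - b%:P * cas_up b H z
    + (\sum_(j < size H) (z + j%:R + b%:P)) * cas b H z
    - z * detf_low (size H) (f H).
  have := @detf_derivation _ (size H) (f H) (fun i => (nth 0%N H i)%:R)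
    (fun j => z + j%:R + b%:P) (fun j => z + j%:R) (- b%:P).
  rewrite addr0 -(@eq_detf _ _ (fun i j => ch b (nth 0%N H i) (z + j%:R))); last first.
    by move=> i j _ _; rewrite fS.
  rewrite -/(cas b H z) -mulr_suml (big_nth 0%N) big_mkord => ->.
    congr (_ * _ + _ - _); rewrite /cas_up; case: (size H) => // p.
    by apply: eq_detf => i j _ _; rewrite fS.
  move=> i j _ _; rewrite -!fS ch_diffeq /f.
  have -> : z + j%:R + 1 = z + j.+1%:R by rewrite -natr1 addrA.
  have -> : z + j%:R - 1 = z - 1 + j%:R by rewrite addrAC.
  ring.
have P : cas b (rcons G g) (z - 1) * cas b G (z + 1)
    = cas b G z * detf_low (size G).+1 (f (rcons G g))
      - cas b (rcons G g) z * detf_low (size G) (f G).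
  have := detf_plucker_low (size G) (f (rcons G g)).
  rewrite /cas size_rcons => E; rewrite {E}[LHS](etrans _ E); last first.
    congr (_ * _); apply: eq_detf => i j iG _.
    by rewrite /f -poly_shiftS -poly_shiftS subrK nthG.
  congr (_ * _ - _ * _).
  - by apply: eq_detf => i j iG _; rewrite fS /f nthG.
  - by apply: eq_detf => i j iG _; rewrite fS.
  case: (size G) nthG => // p nthG; apply: eq_detf => i j iG _.
  by rewrite /f nthG.
have := D (rcons G g); have := D G.
rewrite -mulrA P size_rcons -!mulr_suml -cats1 big_cat big_seq1 cats1 /= big_ord_recr /=.
move: (\sum_(h <- G) _) (\sum_(j < size G) _) (detf_low _ _) (detf _ _) => s t l l'.
move=> E1 E2.
have -> : - z * (cas b G z * l' - cas b (rcons G g) z * l)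
  = cas b G z * (- (z * l')) + cas b (rcons G g) z * (z * l) by ring.
have -> : - (z * l') = (s + g%:R) * cas b (rcons G g) z + b%:P * cas_up b (rcons G g) z
  - (t + (z + (size G)%:R + b%:P)) * cas b (rcons G g) z by rewrite E2; ring.
have -> : z * l = - (s * cas b G z) - b%:P * cas_up b G z + t * cas b G z by rewrite E1; ring.
ring.
Qed.

Lemma cas_comp b G z y : cas b G z \Po y = cas b G (z \Po y).
Proof.
rewrite /cas -/(comp_poly y _) rmorph_detf; apply: eq_detf => i j _ _ /=.
by rewrite ch_comp comp_polyD natr_poly comp_polyC.
Qed.

Lemma cas_up_comp b G z y : cas_up b G z \Po y = cas_up b G (z \Po y).
Proof.
rewrite /cas_up; case: (size G) => [|p]; first by rewrite /= comp_poly0.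
rewrite /= -/(comp_poly y _) rmorph_detf; apply: eq_detf => i j _ _ /=.
by rewrite ch_comp comp_polyD natr_poly comp_polyC.
Qed.

(** The j-th power of the operator (x/a) s_(-1), applied to c_r^a. *)
Definition zeta a (r j : nat) z : {poly R} :=
  (a^-1 ^+ j)%:P * (\prod_(l < j) (z - l%:R)) * ch a r (z - j%:R).

(** Up to a gauge factor, the Casoratian of the c_g^{-a}(-x-1), g in G, and of
    c_r^a(x). *)
Definition mixed a G r z : {poly R} :=
  detf (size G).+1 (fun i j =>
    if i is i'.+1 then ch (- a) (nth 0%N G i') (- z - 1 + j%:R) else zeta a r j z).

Lemma zetaS a r j z :
  zeta a r j.+1 z = (a^-1)%:P * z * zeta a r j (z - 1).
Proof.
rewrite /zeta big_ord_recl exprS polyCM subr0.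
rewrite (eq_bigr (fun l : 'I_j => z - 1 - l%:R)); last first.
  by move=> l _; rewrite lift0 -nat1r opprD addrA.
by rewrite -[j.+1%:R]nat1r opprD addrA; ring.
Qed.

Lemma mixed_comp a G r z y : mixed a G r z \Po y = mixed a G r (z \Po y).
Proof.
rewrite /mixed -/(comp_poly y _) rmorph_detf; apply: eq_detf => [[|i]] j _ _ /=.
  rewrite /zeta !comp_polyM comp_polyC ch_comp comp_polyB natr_poly comp_polyC.
  congr (_ * _ * _); rewrite rmorph_prod; apply: eq_bigr => l _ /=.
  by rewrite comp_polyB natr_poly comp_polyC.
by rewrite ch_comp natr_poly comp_polyD comp_polyB comp_polyC raddfN /= -polyC1 comp_polyC.
Qed.

(** Desnanot-Jacobi: dropping the first column moves z to z-1, by [zetaS] at the cost of a factor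
    z/a in the first row. *)
Lemma mixed_rcons a G g r z :
  mixed a (rcons G g) r z * cas (- a) G (- z)
  = mixed a G r z * cas (- a) (rcons G g) (- z)
    - (a^-1)%:P * z * mixed a G r (z - 1) * cas (- a) (rcons G g) (- z - 1).
Proof.
pose f i j := if i is i'.+1
  then ch (- a) (nth 0%N (rcons G g) i') (- z - 1 + j%:R) else zeta a r j z.
have fS i j : f i.+1 j.+1 = ch (- a) (nth 0%N (rcons G g) i) (- z + j%:R).
  by rewrite /f -poly_shiftS subrK.
have nthG i : (i < size G)%N -> nth 0%N (rcons G g) i = nth 0%N G i.
  by move=> iG; rewrite nth_rcons iG.
have := detf_desnanot (size G) f.
rewrite {1 4}/f /mixed /cas !size_rcons => E.
have -> : detf (size G) (fun i j => ch (- a) (nth 0%N G i) (- z + j%:R))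
    = detf (size G) (fun i j => f i.+1 j.+1).
  by apply: eq_detf => i j iG _; rewrite fS nthG.
rewrite [LHS]E; congr (_ * _ - _ * _).
- by apply: eq_detf => [[|i]] j //; rewrite /f ltnS => iG _; rewrite nthG.
- by apply: eq_detf => i j _ _; rewrite fS.
pose c i := if i is _.+1 then 1 else (a^-1)%:P * z : {poly R}.
transitivity ((\prod_(i < (size G).+1) c i) * (\prod_(i < (size G).+1) 1)
    * mixed a G r (z - 1)); last by rewrite big_ord_recl !big1 ?mulr1.
rewrite -(detf_scale _ _ c (fun => 1)).
apply: eq_detf => [[|i]] j; rewrite /c ?mulr1 ?mul1r; first by rewrite /f zetaS.
rewrite ltnS => iG _; rewrite /f nthG //; congr (ch _ _ _); ring.
Qed.

Definition kappa a g r : {poly R} :=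
  \sum_(l < g.+1) ch a (r.+1 + l) 'X * ch (- a) (g - l) (- 'X).

Lemma mixed_kappa a G r : a != 0 -> G != [::] ->
  mixed a G r 'X * a%:P ^+ size G
  = - (\prod_(g <- G) (r.+1 + g)%:R) * detf (size G) (fun i j =>
      if j is j'.+1 then ch (- a) (nth 0%N G i) (- 'X + j'%:R)
      else kappa a (nth 0%N G i) r).
Proof.
move=> a0 G0; pose x : {poly R} := 'X.
set m := size G; have m0 : (0 < m)%N by rewrite lt0n size_eq0.
(* [al] and [be] are the coefficients on the right of [ch_conv]. The coefficients [ga], [de] and a
   come from the difference equation of c_g^{-a} at -x+j, with r+1 added to the eigenvalue g. *)
pose al := x * ch a r (x - 1); pose be := - (a%:P * ch a r x).
pose ga j : {poly R} := x - j%:R; pose de j : {poly R} := r.+1%:R - x + j%:R - a%:P.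
pose Z (l c : nat) : {poly R} := match c with
  | 0 => (l == 0%N)%:R * 1
  | 1 => (l == 0%N)%:R * al + (l == 1%N)%:R * be
  | j.+2 => (l == j)%:R * ga j + (l == j.+1)%:R * de j + (l == j.+2)%:R * a%:P
  end.
pose Q i j := if i is i'.+1 then ch (- a) (nth 0%N G i') (- x - 1 + j%:R)
  else zeta a r j x.
have aV : a%:P * (a^-1)%:P = 1 :> {poly R} by rewrite -polyCM mulfV.
have zeta0 : zeta a r 0 x = ch a r x.
  by rewrite /zeta big_ord0 expr0 !mul1r subr0.
have zeta1 z : zeta a r 1 z = (a^-1)%:P * z * ch a r (z - 1).
  by rewrite zetaS /zeta big_ord0 expr0 !mul1r subr0.
(* The gauge makes [zeta] a solution of the same difference equation with eigenvalue -(r+1), so that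
   the shifted eigenvalue is 0. *)
have zrec j : zeta a r j x * ga j + zeta a r j.+1 x * de j + zeta a r j.+2 x * a%:P = 0.
  rewrite /zeta !big_ord_recr /= !exprS !polyCM /ga /de.
  move: (_ ^+ j)%:P (\prod_(l < j) _) => A P.
  have := ch_diffeq a r (x - j.+1%:R).
  have -> : x - j.+1%:R + 1 = x - j%:R by rewrite -natr1; ring.
  have -> : x - j.+1%:R - 1 = x - j.+2%:R by rewrite -[j.+2%:R]natr1; ring.
  set h0 := ch a r (x - j%:R); set h1 := ch a r (x - j.+1%:R).
  set h2 := ch a r (x - j.+2%:R); rewrite -!natr1 => E.
  pose y := x - (j%:R + 1); pose c := (a^-1)%:P : {poly R}.
  transitivity (A * P * (x - j%:R) * (h0 * (1 - a%:P * c)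
      + c * y * h2 * (a%:P * c - 1)
      + c * (a%:P * h0 + (r%:R - y - a%:P) * h1 + y * h2))).
    by rewrite /y /c; ring.
  rewrite /c aV subrr -/y in E *.
  have -> : a%:P * h0 + (r%:R - y - a%:P) * h1 + y * h2 = 0.
    by rewrite 2!mulrBl E; ring.
  ring.
(* The row zeta is orthogonal to all columns of Z but the first, and the
   difference equation makes the other rows of Q Z multiples of those of the
   claimed determinant. *)
have P00 : \sum_(l < m.+1) Q 0%N l * Z l 0%N = ch a r x.
  by rewrite /Z (sum_delta (Q 0%N)) // mulr1 /Q zeta0.
have P01 : \sum_(l < m.+1) Q 0%N l * Z l 1%N = 0.
  rewrite /Z; under eq_bigr => l _ do rewrite mulrDr.
  rewrite big_split /= !(sum_delta (Q 0%N)) // /Q zeta0 zeta1 /al /be.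
  transitivity ((1 - a%:P * (a^-1)%:P) * (ch a r x * x * ch a r (x - 1))).
    by ring.
  by rewrite aV subrr mul0r.
have P0S j : (j.+2 < m.+1)%N -> \sum_(l < m.+1) Q 0%N l * Z l j.+2 = 0.
  move=> jm; rewrite /Z; under eq_bigr => l _ do rewrite 2!mulrDr.
  by rewrite !big_split /= !(sum_delta (Q 0%N)) /Q ?zrec //; lia.
have PS1 i : \sum_(l < m.+1) Q i.+1 l * Z l 1%N
    = (r.+1 + nth 0%N G i)%:R * kappa a (nth 0%N G i) r.
  rewrite /Z; under eq_bigr => l _ do rewrite mulrDr.
  rewrite big_split /= !(sum_delta (Q i.+1)) // /Q addr0 subrK ch_conv chsSS chs0 /al /be.
  rewrite chsSS chs0 -/x; ring.
have PSS i j : (j.+2 < m.+1)%N -> \sum_(l < m.+1) Q i.+1 l * Z l j.+2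
    = (r.+1 + nth 0%N G i)%:R * ch (- a) (nth 0%N G i) (- x + j%:R).
  move=> jm; rewrite /Z; under eq_bigr => l _ do rewrite 2!mulrDr.
  rewrite !big_split /= !(sum_delta (Q i.+1)) //; try lia.
  rewrite /Q natrD mulrDl ch_diffeq polyCN.
  have -> : - x - 1 + j%:R = - x + j%:R - 1 by ring.
  have -> : - x - 1 + j.+1%:R = - x + j%:R by ring.
  have -> : - x - 1 + j.+2%:R = - x + j%:R + 1 by ring.
  by rewrite /ga /de; ring.
have := detf_mul m.+1 Q Z.
have -> : detf m.+1 Z = - (a%:P * ch a r x) * a%:P ^+ m.-1.
  rewrite detf_upper; last first.
    move=> l [|[|j]] jl lm; rewrite /Z.
    - by case: l jl lm => // l _ _; rewrite mul0r.
    - by case: l jl lm => [|[|l]] // _ _; rewrite !mul0r addr0.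
    have H c : (c <= j.+2)%N -> (l == c) = false by move=> ?; apply/eqP; lia.
    by rewrite !H ?mul0r ?addr0 //; lia.
  rewrite -(prednK m0) big_ord_recl big_ord_recl /= !mul1r mul0r add0r; congr (_ * _).
  rewrite -[in RHS](card_ord m.-1) -prodr_const; apply: eq_bigr => j _ /=.
  by rewrite /bump /= !add1n eqxx mul1r !gtn_eqF // !mul0r !add0r.
set P := fun i j : nat => _.
have -> : detf m.+1 P = ch a r x * detf m (fun i j => P i.+1 j.+1).
  have := cof_row P (ltn0Sn m) (ltn0Sn m); rewrite eqxx mul1r => <-.
  rewrite big_ord_recl /= {1}/P P00 /cof mul1r big1 ?addr0 // => j _.
  rewrite /bump /= add1n {1}/P; case: j => [[|j] jm] /=; rewrite ?P01 ?P0S ?mul0r //.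
set E := fun i j : nat => if j is j'.+1 then _ else _.
have -> : detf m (fun i j => P i.+1 j.+1) = \prod_(g <- G) (r.+1 + g)%:R * detf m E.
  pose c i : {poly R} := (r.+1 + nth 0%N G i)%:R.
  transitivity ((\prod_(i < m) c i) * (\prod_(i < m) 1) * detf m E); last first.
    by rewrite [X in _ * X * _]big1 // mulr1 (big_nth 0%N) big_mkord.
  rewrite -(detf_scale _ _ c (fun => 1)).
  by apply: eq_detf => i [|j] im jm; rewrite mulr1 /P ?PS1 // PSS.
have -> : a%:P ^+ m = a%:P * a%:P ^+ m.-1 by rewrite -exprS prednK.
rewrite -[detf m.+1 Q]/(mixed a G r x) => H.
apply: (mulfI (ch_neq0 a r)); rewrite mulNr mulrN H -/x; ring.
Qed.

(** For this row the convolution column consists of the [kappa]. Expanding along it leaves cofactors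
    in the remaining columns, where differences are turned back into shifts. *)
Lemma bordered_dual_kappa a F (q := last 0%N F) (G := invol F) r :
  sorted ltn F ->
  bordered_dual a F 'X (fun j => chs a (q.+1 + r) j 'X)
  = detf (size G) (fun i j =>
      if j is j'.+1 then ch (- a) (nth 0%N G i) (- 'X + j'%:R)
      else kappa a (nth 0%N G i) r).
Proof.
move=> sF; rewrite /bordered_dual -/G -/q.
case sG: (size G) => [|p]; first by rewrite !detf0.
rewrite (detf_first_col p (fun i j => ch (- a) (nth 0%N G i) (- 'X + j%:R))
  (fun i => kappa a (nth 0%N G i) r)).
rewrite (detf_first_col p (fun i j => chs (- a) (nth 0%N G i) j (- 'X))).
congr (_ * _); apply: eq_bigr => i _; congr (_ * _).
  have : nth 0%N G i \in G by rewrite mem_nth // sG.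
  rewrite mem_invol // => /andP[/andP[_]]; set g := nth _ _ _; rewrite -/q => gq _.
  rewrite /kappa (big_ord_widen q.+1
    (fun l => ch a (r.+1 + l) 'X * ch (- a) (g - l) (- 'X))) //.
  rewrite [RHS]big_mkcond; apply: eq_bigr => t _ /=; rewrite ltnS.
  rewrite [chs (- a) _ _ _]/chs; case: ifP => tg; last by rewrite mulr0.
  have tq := ltn_ord t; rewrite /chs ifT; last by lia.
  congr (ch _ _ _ * _); lia.
apply: eq_cof_last => s; apply/esym; apply: detf_pascal => k l _ _.
by rewrite ch_addn.
Qed.

Lemma pshift_ch a n (j : nat) : pshift j (charlier a n) = ch a n ('X + j%:R).
Proof. by rewrite /pshift /ch -pmulrn natr_poly. Qed.

Lemma cF_bordered a F n :
  cF a F n = bordered a F 'X (fun j => chs a (n - uF F) j 'X).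
Proof.
transitivity (detf (size F).+1
    (fun i j => ch a (nth 0%N ((n - uF F)%N :: F) i) ('X + j%:R))).
  by congr (\det _); apply/matrixP => i j; rewrite !mxE pshift_ch.
by apply: detf_pascal => [[|i]] j _ _; rewrite ch_addn.
Qed.

Lemma OmegaE a F : Omega a F = toep a F 'X.
Proof.
rewrite -cas_toep /Omega /cas; congr (\det _).
by apply/matrixP => i j; rewrite !mxE pshift_ch.
Qed.

Lemma LambdaE a F : F != [::] ->
  Lambda a F = toep_up a F 'X + (size F)%:R * toep a F 'X.
Proof.
rewrite -cas_up_toep /Lambda /cas_up; case: F => // f F _; congr (\det _).
by apply/matrixP => i j; rewrite !mxE pshift_ch eqSS /=; case: eqP => // ->.
Qed.

Lemma tOmegaE a F : tOmega a F = cas (- a) (invol F) (- 'X).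
Proof.
congr (\det _); apply/matrixP => i j.
by rewrite !mxE natr_poly.
Qed.

(** Duality followed by [mixed_kappa], whose minus sign raises the exponent |I(F)| - 1 to |I(F)|.
    For empty F both sides reduce to c_r^a. *)
Lemma cF_mixed a F n r : a != 0 -> sorted ltn F -> all (fun f => 0 < f)%N F ->
  (n - uF F = if F == [::] then r else (last 0 F).+1 + r)%N ->
  (\prod_(g <- invol F) (r.+1 + g)%:R) * cF a F n
  = (-1) ^+ (uF F + size (invol F)) * a%:P ^+ size (invol F) * mixed a (invol F) r 'X.
Proof.
move=> a0 sF pF; case: eqVneq => [->|F0] nE.
  rewrite uF_nil subn0 in nE; rewrite cF_nil uF_nil big_nil expr0 !mul1r.
  rewrite /mixed /detf det_mx11 mxE /= /zeta big_ord0 expr0 !mul1r subr0 nE.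
  by rewrite /ch comp_polyXr.
have [_ _ D] := toep_dual F0 sF pF a 'X.
rewrite cF_bordered D nE (bordered_dual_kappa _ _ sF).
set G := invol F; have G0 : G != [::] by rewrite /G invol_down //; case: invol.
have := mixed_kappa r a0 G0; set dt := detf _ _ => H.
rewrite mulrCA -[in RHS]mulrA [_ * mixed _ _ _ _]mulrC H mulNr mulrN -mulNr.
by congr (_ * _); case: (G) G0 => // g s _ /=; rewrite addnS exprS mulN1r opprK.
Qed.
End Casoratians.

(** * Operators *)

Section Shift.
Variable R : realType.
Implicit Types (f g : ratfun R) (l : int) (p q : {poly R}).

Lemma ratfunP f : exists p q, q != 0 /\ f = p%:F / q%:F.
Proof.
by have := repr_frac f; set r := generic_quotient.repr f => ->;
  exists \n_r, \d_r; split=> //; exact: denom_ratioP.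
Qed.

Lemma comp_polyNl p q : (- p) \Po q = - (p \Po q).
Proof. exact: raddfN. Qed.

Lemma pshiftD l p q : pshift l (p + q) = pshift l p + pshift l q.
Proof. exact: comp_polyD. Qed.

Lemma pshiftM l p q : pshift l (p * q) = pshift l p * pshift l q.
Proof. exact: comp_polyM. Qed.

Lemma pshift_neq0 l q : q != 0 -> (pshift l q)%:F != 0 :> ratfun R.
Proof. by move=> q0; rewrite tofrac_eq0 pshift_eq0. Qed.

Lemma shiftM l f g : shift l (f * g) = shift l f * shift l g.
Proof.
have [p [q [q0 ->]]] := ratfunP f; have [p' [q' [q'0 ->]]] := ratfunP g.
rewrite mulf_div -!tofracM !shift_frac ?mulf_neq0 // !pshiftM !tofracM.
by rewrite mulf_div.
Qed.

Lemma shiftD l f g : shift l (f + g) = shift l f + shift l g.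
Proof.
have [p [q [q0 ->]]] := ratfunP f; have [p' [q' [q'0 ->]]] := ratfunP g.
rewrite addf_div ?tofrac_eq0 // -!tofracM -tofracD !shift_frac ?mulf_neq0 //.
by rewrite pshiftD !pshiftM addf_div ?pshift_neq0 // tofracD !tofracM.
Qed.

Lemma shiftN l f : shift l (- f) = - shift l f.
Proof.
have [p [q [q0 ->]]] := ratfunP f.
by rewrite -mulNr -tofracN !shift_frac // /pshift comp_polyNl tofracN mulNr.
Qed.

Lemma shiftV l f : shift l f^-1 = (shift l f)^-1.
Proof.
have [p [q [q0 ->]]] := ratfunP f; have [->|p0] := eqVneq p 0.
  have s0 : shift l 0 = 0 :> ratfun R.
    by rewrite -tofrac0 shift_tofrac /pshift comp_poly0.
  by rewrite tofrac0 mul0r invr0 s0 invr0.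
by rewrite invf_div !shift_frac // invf_div.
Qed.

Lemma shift0 f : shift 0 f = f.
Proof.
have [p [q [q0 ->]]] := ratfunP f.
by rewrite shift_frac // /pshift addr0 !comp_polyXr.
Qed.

Lemma shift_shift l l' f : shift l (shift l' f) = shift (l + l') f.
Proof.
have [p [q [q0 ->]]] := ratfunP f.
have C r : pshift l (pshift l' r) = pshift (l + l') r.
  rewrite /pshift -comp_polyA comp_polyD comp_polyX comp_polyC.
  by rewrite -addrA -polyCD -intrD.
by rewrite !shift_frac ?pshift_eq0 // !C.
Qed.

Lemma shift_cst l (a : R) : shift l (cst a) = cst a.
Proof. by rewrite shift_tofrac /pshift comp_polyC. Qed.

Lemma shiftX l : shift l 'X%:F = 'X%:F + cst l%:~R :> ratfun R.
Proof. by rewrite shift_tofrac /pshift comp_polyX tofracD. Qed.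

Lemma cst_neq0 (a : R) : a != 0 -> cst a != 0.
Proof. by rewrite tofrac_eq0 polyC_eq0. Qed.

Lemma cstV (a : R) : a != 0 -> (cst a)^-1 = cst a^-1.
Proof.
move=> a0; have M : cst a * cst a^-1 = 1.
  by rewrite -tofracM -polyCM mulfV // polyC1 tofrac1.
exact (mulr1_eq M).
Qed.

Lemma natr_tofrac n : n%:R = (n%:R : {poly R})%:F :> ratfun R.
Proof. by rewrite rmorph_nat. Qed.

End Shift.

(** * Rational identities behind the factorizations *)

Section FieldIdentities.
Variable K : fieldType.
Implicit Types (x k A u p q t s w v y : K).

Lemma opD_scale x k A u e t0 t1 w0 w1 c y z y' :
  e != 0 -> t0 != 0 -> t1 != 0 ->
  - (x * (e * t1 / (e * t0))) * y
  + (x + k + A + u - A * (e * (c * t1 - w1) / (e * t1))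
     + A * (e * (c * t0 - w0) / (e * t0))) * z
  + - (A * (e * t0 / (e * t1))) * y'
  = - (x * (t1 / t0)) * y + (x + (k + u) + A + A * (w1 / t1) - A * (w0 / t0)) * z
    - A * (t0 / t1) * y'.
Proof. by move=> e0 h0 h1; field; rewrite ?e0 ?h0 ?h1. Qed.

(** The last two hypotheses are the two Pluecker relations; solving them for [s1] and [sm] leaves an
    identity of rational expressions. *)
Lemma opCE_field x k A u p q t0 t1 s0 s1 sm w0 w1 v0 ym y y1 :
  x != 0 -> A != 0 -> t0 != 0 -> t1 != 0 -> s0 != 0 -> q = k + p ->
  t0 * s1 = w1 * s0 - v0 * t1 ->
  x * t1 * sm = (q + x - p + A) * t0 * s0 - A * w0 * s0 + A * v0 * t0 ->
  - (x * (t1 / t0)) * ym + (x + (k + u) + A + A * (w1 / t1) - A * (w0 / t0)) * y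
    - A * (t0 / t1) * y1
  = - (x * t1 / (A * s0)) * (A * (s0 / t0) * ym - A * (sm / t0) * y)
    + t0 / s0 * (A * (s1 / t1) * y - A * (s0 / t1) * y1) + u * y.
Proof.
move=> x0 A0 ht0 ht1 hs0 -> E1 E2.
have -> : s1 = (w1 * s0 - v0 * t1) / t0 by rewrite -E1 mulrC mulKf.
have -> : sm = ((k + p + x - p + A) * t0 * s0 - A * w0 * s0 + A * v0 * t0) / (x * t1).
  by rewrite -E2 mulrC mulKf // mulf_neq0.
by field; rewrite ?x0 ?A0 ?ht0 ?ht1 ?hs0.
Qed.

(** Here the second Pluecker relation is taken at x+1, and the unknowns eliminated are [w1] and
    [t2]. *)
Lemma opEC_field x k A u p q t0 t1 t2 s0 s1 w1 v0 v1 ym y y1 :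
  x + 1 != 0 -> A != 0 -> t1 != 0 -> s0 != 0 -> s1 != 0 -> q = k + p ->
  t0 * s1 = w1 * s0 - v0 * t1 ->
  (x + 1) * t2 * s0 = (q + (x + 1) - p + A) * t1 * s1 - A * w1 * s1 + A * v1 * t1 ->
  - (x * (s1 / s0)) * ym + (x + u + A + A * (v1 / s1) - A * (v0 / s0)) * y
    - A * (s0 / s1) * y1
  = A * (s1 / t1) * (- (x * t1 / (A * s0)) * ym + t0 / s0 * y)
    - A * (s0 / t1) * (- ((x + 1) * t2 / (A * s1)) * y + t1 / s1 * y1)
    + (u - k - 1) * y.
Proof.
move=> x0 A0 ht1 hs0 hs1 -> E1 E2.
have W : w1 = (t0 * s1 + v0 * t1) / s0 by rewrite E1 subrK mulfK.
have -> : t2 = ((k + p + (x + 1) - p + A) * t1 * s1 - A * w1 * s1 + A * v1 * t1)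
    / ((x + 1) * s0).
  by apply: (canRL (mulfK (mulf_neq0 x0 hs0))); rewrite -E2; ring.
by rewrite W; field; rewrite ?x0 ?A0 ?ht1 ?hs0 ?hs1.
Qed.

Lemma opC_field x A B t0 t1 s0 c cm c' m m' mm N P e e' :
  A != 0 -> s0 != 0 -> N != 0 -> P != 0 ->
  P * c' = e' * B * m' -> P * cm = e' * B * mm ->
  P * N * c = e' * e * (B * A) * m -> e * e = 1 ->
  m * s0 = m' * t0 - A^-1 * x * mm * t1 ->
  - (x * t1 / (A * s0)) * cm + t0 / s0 * c' = e * (N / A) * c.
Proof.
move=> A0 hs0 N0 P0 E' Em E ee M.
have -> : c' = e' * B * m' / P by rewrite -E' mulrC mulKf.
have -> : cm = e' * B * mm / P by rewrite -Em mulrC mulKf.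
have -> : c = e' * e * (B * A) * m / (P * N) by rewrite -E mulrC mulKf // mulf_neq0.
have -> : m = (m' * t0 - A^-1 * x * mm * t1) / s0 by rewrite -M mulfK.
have -> : e * (N / A) * (e' * e * (B * A) * ((m' * t0 - A^-1 * x * mm * t1) / s0) / (P * N))
  = (e * e) * ((N / A) * (e' * (B * A) * ((m' * t0 - A^-1 * x * mm * t1) / s0) / (P * N))).
  by ring.
by rewrite ee mul1r; field; rewrite ?A0 ?hs0 ?N0 ?P0.
Qed.

End FieldIdentities.

(** * The operators in terms of dual Casoratians, and the theorem *)

Section Factorization.
Variable R : realType.
Implicit Types (a : R) (F G : seq nat).

(** The argument is -x-i, so that [shift l] merely adds l to the index. *)
Definition ratcas b G (i : int) : ratfun R := (cas b G (- 'X - (i%:~R)%:P))%:F.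
Definition ratcas_up b G (i : int) : ratfun R := (cas_up b G (- 'X - (i%:~R)%:P))%:F.

Lemma shift_ratcas b G l i : shift l (ratcas b G i) = ratcas b G (l + i).
Proof.
rewrite /ratcas shift_tofrac /pshift cas_comp comp_polyB comp_polyNl.
by rewrite comp_polyX comp_polyC opprD -addrA -opprD -polyCD -intrD.
Qed.

Lemma shift_ratcas_up b G l i : shift l (ratcas_up b G i) = ratcas_up b G (l + i).
Proof.
rewrite /ratcas_up shift_tofrac /pshift cas_up_comp comp_polyB comp_polyNl.
by rewrite comp_polyX comp_polyC opprD -addrA -opprD -polyCD -intrD.
Qed.

(** A shift reduces to i = 0, where the polynomial has a nonzero value at x = 0 by [toep_at0]. *)
Lemma ratcas_neq0 b G i : b != 0 -> sorted ltn G -> ratcas b G i != 0.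
Proof.
move=> b0 sG; have -> : ratcas b G i = shift i (ratcas b G 0).
  by rewrite shift_ratcas addr0.
rewrite shift_tofrac tofrac_eq0 pshift_eq0 mulr0z subr0.
have [||v v0] := @toep_at0 R b G (- 'X) _ _ sG => //.
  by rewrite hornerN hornerX oppr0.
rewrite -cas_toep => E; apply: contraTneq v0 => C; move: E.
rewrite C horner0 => /esym/eqP; rewrite !mulf_eq0 invr_eq0 !expf_eq0 oppr_eq0.
by rewrite (negbTE b0) !andbF /= => /eqP->; rewrite ltxx.
Qed.

Lemma tOmega_ratcas a F : (tOmega a F)%:F = ratcas (- a) (invol F) 0.
Proof. by rewrite tOmegaE /ratcas subr0. Qed.

(** By duality Lambda_F is, up to the sign of Omega_F, the constant |F| + |I(F)| times the dual
    Casoratian minus the gapped one; sign and constant drop out by [opD_scale]. *)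
Lemma opDE a F f (t := ratcas (- a) (invol F)) (w := ratcas_up (- a) (invol F)) :
  a != 0 -> sorted ltn F -> all (fun f => 0 < f)%N F ->
  opD a F f = - ('X%:F * (t 1 / t 0)) * shift (-1) f
    + ('X%:F + (size F + uF F)%:R + cst a + cst a * (w 1 / t 1) - cst a * (w 0 / t 0)) * f
    - cst a * (t 0 / t 1) * shift 1 f.
Proof.
move=> a0 sF pF; have Na0 : - a != 0 by rewrite oppr_eq0.
have [F0|F0] := eqVneq F [::].
  rewrite /t /w F0 opD_nil /= shift0 /ratcas /ratcas_up /cas /cas_up /= !detf0.
  by rewrite tofrac0 tofrac1 !mul0r !mulr0 uF_nil !divr1 !mulr1 addr0 subr0 !addr0 !mulNr.
have [T U _] := toep_dual F0 sF pF a 'X.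
set s : {poly R} := (-1) ^+ (uF F + size F) in T U.
have s0 : s%:F != 0 :> ratfun R by rewrite tofrac_eq0 signr_eq0.
have ss : shift 1 s%:F = s%:F by rewrite shift_tofrac /s /pshift rmorphXn /= rmorphN1.
have t0 i : t i != 0 by rewrite ratcas_neq0 ?invol_sorted.
have Om : (Omega a F)%:F = s%:F * t 0.
  by rewrite OmegaE T tofracM /t /ratcas subr0 cas_toep.
have La : (Lambda a F)%:F = s%:F * ((size F + size (invol F))%:R * t 0 - w 0).
  rewrite LambdaE // T U /w /t /ratcas /ratcas_up !subr0 cas_up_toep cas_toep.
  rewrite natr_tofrac -tofracM -tofracB -tofracM natrD; congr (_%:F); ring.
rewrite /opD /= Om La !shiftM shiftD shiftN shiftM ss.
rewrite [shift 1 (t 0)]shift_ratcas [shift 1 (w 0)]shift_ratcas_up addr0 -/t -/w shift0.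
set c : ratfun R := (size F + _)%:R; have -> : shift 1 c = c.
  by rewrite /c natr_tofrac shift_tofrac /pshift natr_poly comp_polyC.
rewrite [(size F + uF F)%:R]natrD.
move: s0 (t0 0) (t0 1); clear.
move: (s%:F) (t 0) (t 1) (w 0) (w 1) c (cst a) (shift (-1) f) (shift 1 f) 'X%:F.
move: (size F)%:R (uF F)%:R => k u e h0 h1 w0 w1 c A y y' x.
move: f => z e0 t0 t1.
exact (opD_scale x k A u w0 w1 c y z y' e0 t0 t1).
Qed.

Lemma ratcas_rcons_up b G g (t := ratcas b (rcons G g)) (s := ratcas b G)
    (w := ratcas_up b (rcons G g)) (v := ratcas_up b G) :
  t 0 * s 1 = w 1 * s 0 - v 0 * t 1 :> ratfun R.
Proof.
rewrite /t /s /w /v /ratcas /ratcas_up -!tofracM -tofracB subr0.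
by have := cas_rcons_up b G g (- 'X - (1%:~R)%:P); rewrite polyC1 subrK => ->.
Qed.

Lemma ratcas_rcons_low a G g (t := ratcas (- a) (rcons G g)) (s := ratcas (- a) G)
    (w := ratcas_up (- a) (rcons G g)) (v := ratcas_up (- a) G) (x : ratfun R := 'X%:F) :
  x * t 1 * s (-1) = (g%:R + x - (size G)%:R + cst a) * t 0 * s 0
    - cst a * w 0 * s 0 + cst a * v 0 * t 0.
Proof.
rewrite /t /s /w /v /x /ratcas /ratcas_up /cst !natr_tofrac.
rewrite -!(tofracD, tofracM, tofracB); congr (_%:F).
have -> : - 'X - ((-1)%:~R)%:P = - 'X + 1 :> {poly R} by rewrite mulrN1z polyCN opprK.
have -> : - 'X - (1%:~R)%:P = - 'X - 1 :> {poly R} by rewrite mulr1z.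
have := cas_rcons_low (- a) G g (- 'X); rewrite opprK subr0 => ->.
by rewrite polyCN; ring.
Qed.

Lemma opCE a F (f : ratfun R) (t := ratcas (- a) (invol F))
    (s := ratcas (- a) (invol (down F))) :
  opC a F f = - ('X%:F * t 1 / (cst a * s 0)) * shift (-1) f + t 0 / s 0 * f.
Proof. by rewrite /opC /= !tOmega_ratcas shift_ratcas addr0 shift0. Qed.

Lemma opEE a F (f : ratfun R) (t := ratcas (- a) (invol F))
    (s := ratcas (- a) (invol (down F))) :
  opE a F f = cst a * (s 1 / t 1) * f - cst a * (s 0 / t 1) * shift 1 f.
Proof.
by rewrite /opE /= !tOmega_ratcas !shift_ratcas !addr0 shift0 mulNr.
Qed.

End Factorization.

Theorem lemma3p7 (R : realType) (a : R) (F : seq nat) :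
  a != 0 ->
  F != [::] -> sorted ltn F -> all (fun f => 0 < f)%N F ->
  (forall n : nat, (Omega a F).[n%:R] != 0) ->
  [/\ opD a (down F) =1
        (opE a F \o opC a F)
        \+ (((uF F)%:R - (size F)%:R - 1) \*o shift 0),
      opD a F =1 (opC a F \o opE a F) \+ ((uF F)%:R \*o shift 0)
    & forall n : nat, (vF F <= n)%N ->
        opC a F (cF a (down F) (n - size F - 1))%:F =
        (-1) ^+ (uF F + uF (down F) + 1) * ((n%:R - (uF F)%:R) / cst a)
          * (cF a F n)%:F].
Proof.
move=> a0 F0 sF pF _.
have Na0 : - a != 0 by rewrite oppr_eq0.
have [sF' pF'] := down_sorted sF pF.
set F' := down F in sF' pF' *; set G' := invol F'; set q := last 0%N F.
have GE : invol F = rcons G' q := invol_down F0 sF pF.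
have sG := invol_sorted F; have sG' := invol_sorted F'.
have kq := size_invol_down F0 sF pF; have uE := uF_down F0 sF pF.
pose x : ratfun R := 'X%:F; pose A := cst a.
have A0 : A != 0 := cst_neq0 a0.
have x0 : x != 0 by rewrite tofrac_eq0 polyX_eq0.
have x1 : x + 1 != 0.
  by rewrite /x -[1]tofrac1 -tofracD tofrac_eq0 -size_poly_eq0 -polyC1 size_XaddC.
pose t := ratcas (- a) (invol F); pose s := ratcas (- a) G'.
pose w := ratcas_up (- a) (invol F); pose v := ratcas_up (- a) G'.
have t0 i : t i != 0 by rewrite ratcas_neq0.
have s0 i : s i != 0 by rewrite ratcas_neq0.
have UP : t 0 * s 1 = w 1 * s 0 - v 0 * t 1.
  by rewrite /t /w GE; exact: ratcas_rcons_up.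
have LOW : x * t 1 * s (-1) = (q%:R + x - (size G')%:R + A) * t 0 * s 0
    - A * w 0 * s 0 + A * v 0 * t 0.
  by rewrite /t /w GE; exact: ratcas_rcons_low.
have qE : q%:R = (size F)%:R + (size G')%:R :> ratfun R by rewrite /q -kq natrD.
have shT (l i : int) : shift l (t i) = t (l + i) by exact: shift_ratcas.
have shS (l i : int) : shift l (s i) = s (l + i) by exact: shift_ratcas.
have shW (l i : int) : shift l (w i) = w (l + i) by exact: shift_ratcas_up.
have shV (l i : int) : shift l (v i) = v (l + i) by exact: shift_ratcas_up.
have shA l : shift l A = A by exact: shift_cst.
have shn l n : shift l n%:R = n%:R :> ratfun R.
  by rewrite natr_tofrac shift_tofrac /pshift natr_poly comp_polyC.
have shx : shift 1 x = x + 1 by rewrite shiftX.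
(* In E_F C_F the coefficients of C_F are evaluated at x+1. *)
have LOW1 : (x + 1) * t (1 + 1) * s 0 = (q%:R + (x + 1) - (size G')%:R + A) * t 1 * s 1
    - A * w 1 * s 1 + A * v 1 * t 1.
  have := congr1 (shift 1) LOW.
  by rewrite !(shiftD, shiftN, shiftM) !shn shA shx !(shT, shS, shW, shV) !addr0 addrN.
split.
- move=> f; rewrite opDE // uE.
  rewrite /= opEE opCE shift0.
  have -> : shift 1 (- ('X%:F * t 1 / (cst a * s 0)) * shift (-1) f + t 0 / s 0 * f)
    = - ((x + 1) * t (1 + 1) / (A * s 1)) * f + t 1 / s 1 * shift 1 f.
    have : shift 1 (shift (-1) f) = f by rewrite shift_shift shift0.
    move: (shift (-1) f) => y yE.
    by rewrite shiftD !shiftM shiftN !shiftM !shiftV !shiftM shA shx !(shT, shS) yE !addr0.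
  exact (opEC_field (uF F)%:R (shift (-1) f) f (shift 1 f)
    x1 A0 (t0 1) (s0 0) (s0 1) qE UP LOW1).
- move=> f; rewrite opDE // natrD /= opCE opEE shift0.
  have -> : shift (-1) (cst a * (s 1 / t 1) * f - cst a * (s 0 / t 1) * shift 1 f)
    = A * (s 0 / t 0) * shift (-1) f - A * (s (-1) / t 0) * f.
    have : shift (-1) (shift 1 f) = f by rewrite shift_shift shift0.
    move: (shift 1 f) => y yE.
    by rewrite shiftD shiftN !shiftM !shiftV shA !(shT, shS) yE !addr0 !addNr.
  exact (opCE_field (uF F)%:R (shift (-1) f) f (shift 1 f)
    x0 A0 (t0 0) (t0 1) (s0 0) qE UP LOW).
move=> n vn; have [nE nE'] := down_index F0 sF pF vn.
set r := (n - vF F)%N in nE nE'; set n' := (n - size F - 1)%N in nE' *.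
pose m := size G'; have un : (uF F <= n)%N.
  by apply: leq_trans vn; rewrite vF_uF // leqW ?leq_addr.
have nEF : (n - uF F = if F == [::] then r else (last 0%N F).+1 + r)%N.
  by rewrite (negbTE F0) nE.
have sgn (k : nat) : (-1) ^+ k = ((-1) ^+ k : {poly R})%:F :> ratfun R.
  by rewrite rmorphXn rmorphN1.
have H' := cF_mixed a0 sF' pF' nE'.
have H := cF_mixed a0 sF pF nEF.
(* The product over I(F) is that over I(F_down) times the factor of f_k, which is r+1+f_k = n -
   u_F. *)
rewrite GE size_rcons -cats1 big_cat big_seq1 cats1 /= -/G' -/q -/m in H H'.
pose P : {poly R} := \prod_(g <- G') (r.+1 + g)%:R.
have P0 : P%:F != 0 :> ratfun R.
  rewrite tofrac_eq0 prodf_seq_neq0; apply/allP => g _ /=.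
  by rewrite addSn natrS_poly_neq0.
have NB : (n - uF F)%:R = n%:R - (uF F)%:R :> ratfun R := natrB _ un.
have N0 : (n%:R - (uF F)%:R : ratfun R) != 0.
  by rewrite -NB nE addSn natr_tofrac tofrac_eq0 natrS_poly_neq0.
have pm : pshift (-1) (mixed a G' r 'X) = mixed a G' r ('X - 1).
  by rewrite /pshift mixed_comp comp_polyX mulrN1z polyCN.
have pP : pshift (-1) P = P.
  rewrite /pshift /P rmorph_prod; apply: eq_bigr => g _ /=.
  by rewrite natr_poly comp_polyC.
have pB k l : pshift (-1) ((-1) ^+ k * a%:P ^+ l) = (-1) ^+ k * a%:P ^+ l.
  by rewrite /pshift rmorphM !rmorphXn /= rmorphN1 comp_polyC.
have Hm : P * pshift (-1) (cF a F' n')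
    = (-1) ^+ (uF F' + m) * a%:P ^+ m * mixed a G' r ('X - 1).
  by rewrite -pm -(pB (uF F' + m)%N m) -pshiftM -H' pshiftM pP.
have ee : (-1) ^+ (uF F + uF F' + 1) * (-1) ^+ (uF F + uF F' + 1) = 1 :> ratfun R.
  by rewrite -expr2 sqrr_sign.
rewrite opCE.
rewrite shift_tofrac.
have E1 : P%:F * (cF a F' n')%:F
    = (-1) ^+ (uF F' + m) * (a%:P ^+ m)%:F * (mixed a G' r 'X)%:F :> ratfun R.
  by rewrite sgn -!tofracM H'.
have E2 : P%:F * (pshift (-1) (cF a F' n'))%:F
    = (-1) ^+ (uF F' + m) * (a%:P ^+ m)%:F * (mixed a G' r ('X - 1))%:F :> ratfun R.
  by rewrite sgn -!tofracM -Hm.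
have E3 : P%:F * (n%:R - (uF F)%:R) * (cF a F n)%:F
    = (-1) ^+ (uF F' + m) * (-1) ^+ (uF F + uF F' + 1) * ((a%:P ^+ m)%:F * A)
      * (mixed a (rcons G' q) r 'X)%:F :> ratfun R.
  rewrite -NB nE natr_tofrac !sgn -!tofracM; congr (_%:F).
  have -> : (q.+1 + r)%N = (r.+1 + q)%N by rewrite !addSn addnC.
  rewrite H exprSr.
  have -> : (-1) ^+ (uF F + m.+1)
      = (-1) ^+ (uF F' + m) * (-1) ^+ (uF F + uF F' + 1) :> {poly R}.
    rewrite -exprD -signr_odd -[RHS]signr_odd; congr (_ ^+ nat_of_bool _).
    by rewrite !oddD /=; case: (odd (uF F)) (odd (uF F')) (odd m) => [] [] [].
  by [].
have E4 : (mixed a (rcons G' q) r 'X)%:F * s 0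
    = (mixed a G' r 'X)%:F * t 0 - A^-1 * x * (mixed a G' r ('X - 1))%:F * t 1.
  rewrite /A (cstV a0) /s /t GE /ratcas subr0 polyC1 -!(tofracM, tofracB).
  by rewrite mixed_rcons.
exact (opC_field A0 (s0 0) N0 P0 E1 E2 E3 ee E4).
Qed.
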